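(* Let $R$ be a one-dimensional local Noetherian ring with finite residue field $k$, and let $n$ be a positive integer. Then every ideal of $R$ has an $n$-generated reduction if and only if $$|\operatorname{Max}(\overline{R_{red}})| \leq \frac{|k|^{n+1}-|k|}{|k|-1}.$$
   Context: A reduction of an ideal $I$ is an ideal $J\subseteq I$ such that $I^{m+1}=JI^m$ for some $m>0$; it is $n$-generated if it can be generated by $n$ elements. $R_{red}=R/\sqrt{0}$, $\overline{A}$ is the integral closure of a ring $A$ in its total quotient ring, and $\operatorname{Max}(A)$ is the set of maximal ideals of $A$. *)

(* Defs.v *)
From mathcomp Require Import all_boot all_order all_algebra.
Set Implicit Arguments.
Unset Strict Implicit.
Unset Printing Implicit Defensive.
Import GRing.Theory.
Local Open Scope ring_scope.

Section CommAlg.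
Variable R : comNzRingType.

Definition subI (I J : R -> Prop) := forall x, I x -> J x.
Definition eqI (I J : R -> Prop) := forall x, I x <-> J x.

Definition is_ideal (I : R -> Prop) : Prop :=
  [/\ I 0, (forall x y, I x -> I y -> I (x + y)) & (forall r x, I x -> I (r * x))].

Definition gen_ideal (s : seq R) : R -> Prop :=
  fun x => exists c : nat -> R, x = \sum_(i < size s) c i * s`_i.

Definition fin_gen (I : R -> Prop) := exists s : seq R, eqI I (gen_ideal s).

Definition n_generated (n : nat) (I : R -> Prop) :=
  exists s : seq R, size s = n /\ eqI I (gen_ideal s).

Definition mulI (I J : R -> Prop) : R -> Prop :=
  fun x => exists s : seq (R * R),
    (forall p, p \in s -> I p.1 /\ J p.2) /\ x = \sum_(p <- s) p.1 * p.2.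

Definition powI (I : R -> Prop) (m : nat) : R -> Prop :=
  iter m (mulI I) (fun _ => True).

Definition reduction (J I : R -> Prop) :=
  subI J I /\ exists m : nat, (0 < m)%N /\ eqI (powI I m.+1) (mulI J (powI I m)).

Definition prime_ideal (P : R -> Prop) :=
  [/\ is_ideal P, ~ P 1 & forall x y, P (x * y) -> P x \/ P y].

Definition maximal_ideal (M : R -> Prop) :=
  [/\ is_ideal M, ~ M 1 &
      forall I, is_ideal I -> subI M I -> eqI I M \/ I 1].

Definition noetherian := forall I, is_ideal I -> fin_gen I.

Definition strict_sub (I J : R -> Prop) := subI I J /\ ~ subI J I.
Definition krull_dim_one :=
  (exists P Q, [/\ prime_ideal P, prime_ideal Q & strict_sub P Q]) /\
  ~ (exists P Q S, [/\ prime_ideal P, prime_ideal Q, prime_ideal S,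
                       strict_sub P Q & strict_sub Q S]).

Definition local_with (m : R -> Prop) :=
  maximal_ideal m /\ forall M, maximal_ideal M -> eqI M m.

Definition residue_card (m : R -> Prop) (q : nat) :=
  exists s : seq R, [/\ size s = q,
    (forall i j, (i < q)%N -> (j < q)%N -> m (s`_i - s`_j) -> i = j) &
    (forall x, exists2 i, (i < q)%N & m (x - s`_i))].

Definition nilpotent_el (x : R) := exists k : nat, x ^+ k = 0.

(* s is a non-zero-divisor of R_red = R / nilradical *)
Definition nzd_red (s : R) := forall a, nilpotent_el (a * s) -> nilpotent_el a.

(* g : R -> T presents T as the total quotient ring of R_red
   (localisation of R_red at its non-zero-divisors), via its
   characterising properties. *)
Definition total_quotient_of_red (T : comNzRingType) (g : {rmorphism R -> T}) :=
  [/\ (forall a, g a = 0 <-> nilpotent_el a),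
      (forall s, nzd_red s -> exists t, g s * t = 1) &
      (forall t, exists a s, nzd_red s /\ t * g s = g a)].

End CommAlg.

Section Closure.
Variables (R T : comNzRingType) (g : {rmorphism R -> T}).

(* t is integral over (the image of) R, i.e. over R_red *)
Definition integral_el (t : T) :=
  exists p : {poly R}, p \is monic /\ (map_poly g p).[t] = 0.

(* ideals / maximal ideals of the subring of integral elements
   (the integral closure of R_red in T), as subsets of T *)
Definition closure_ideal (I : T -> Prop) :=
  [/\ (forall x, I x -> integral_el x), I 0,
      (forall x y, I x -> I y -> I (x + y)) &
      (forall r x, integral_el r -> I x -> I (r * x))].

Definition closure_maximal (M : T -> Prop) :=
  [/\ closure_ideal M, ~ M 1 &
      forall I, closure_ideal I -> (forall x, M x -> I x) ->
        (forall x, I x <-> M x) \/ I 1].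

Definition card_max_closure_le (N : nat) :=
  forall s : seq (T -> Prop),
    (forall i, (i < size s)%N -> closure_maximal (nth (fun _ => False) s i)) ->
    (forall i j, (i < size s)%N -> (j < size s)%N ->
       (forall x, nth (fun _ => False) s i x <-> nth (fun _ => False) s j x) -> i = j) ->
    (size s <= N)%N.

End Closure.

(* Main.v *)
(** Write A for the integral closure of R_red and M for its maximal ideals.  For
    J ⊆ I, the ideal J is a reduction of I as soon as JA = IA, by the determinant
    trick.  This equality is tested at each M: since every pair x, y of R satisfies
    a x = b y with a, b in A not both in M, the ideal IA is principal near M, and
    the elements of I not generating it there form a proper R-submodule containing
    mI.  So each M forbids a proper subspace of the k-space I/mI, and n elements of
    I avoiding all of them exist when there are at most q + ... + q^n of them, by
    choosing the elements one at a time so that each lies in less than 1/q of the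
    remaining subspaces.

    The relation a x = b y comes from counting.  If c is a non-zero-divisor then
    R/c is finite, so the products c^i x^j of small degree cannot be independent
    modulo m; this yields a polynomial equation for x/c with a unit coefficient,
    and A is integrally closed.

    Conversely, 1 + q + ... + q^n maximal ideals can be labelled by all the points
    of P^n(k).  The Chinese remainder theorem gives u_0, ..., u_n in A with those
    homogeneous coordinates at the corresponding M, and for a common denominator c
    the ideal (c u_0, ..., c u_n) has no n-generated reduction: n linear forms
    have a common zero in P^n(k). *)

Require Import Defs.
From mathcomp Require Import all_boot all_order all_algebra.
From mathcomp Require Import perm boolp classical_sets.
From mathcomp Require Import zify ring.
Set Implicit Arguments.
Unset Strict Implicit.
Unset Printing Implicit Defensive.
Import GRing.Theory.

(** * Ideals as predicates *)

Section Ideals.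
Local Open Scope ring_scope.
Variable R : comNzRingType.
Implicit Types (I J L : R -> Prop) (s : seq R).

Lemma ideal_zero I : is_ideal I -> I 0. Proof. by case. Qed.

Lemma ideal_add I x y : is_ideal I -> I x -> I y -> I (x + y).
Proof. by case=> _ H _; apply: H. Qed.

Lemma ideal_mull I r x : is_ideal I -> I x -> I (r * x).
Proof. by case=> _ _ H; apply: H. Qed.

Lemma ideal_mulr I r x : is_ideal I -> I x -> I (x * r).
Proof. by move=> II Ix; rewrite mulrC; apply: ideal_mull. Qed.

Lemma ideal_opp I x : is_ideal I -> I x -> I (- x).
Proof. by move=> II Ix; rewrite -mulN1r; apply: ideal_mull. Qed.

Lemma ideal_sub I x y : is_ideal I -> I x -> I y -> I (x - y).
Proof. by move=> II Ix Iy; apply: ideal_add => //; apply: ideal_opp. Qed.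

Lemma ideal_sum I (X : Type) (r : seq X) (P : pred X) (F : X -> R) :
  is_ideal I -> (forall i, P i -> I (F i)) -> I (\sum_(i <- r | P i) F i).
Proof. by move=> II IF; elim/big_ind: _ => // *; [exact: ideal_zero|exact: ideal_add]. Qed.

Lemma ideal_exp I x k : is_ideal I -> I x -> (0 < k)%N -> I (x ^+ k).
Proof. by move=> II Ix; case: k => // k _; rewrite exprS; apply: ideal_mulr. Qed.

Lemma gen_ideal_ideal s : is_ideal (gen_ideal s).
Proof.
split.
- by exists (fun=> 0); rewrite big1 // => i _; rewrite mul0r.
- move=> _ _ [c ->] [d ->]; exists (fun i => c i + d i).
  by rewrite -big_split; apply: eq_bigr => i _; rewrite mulrDl.
- move=> r _ [c ->]; exists (fun i => r * c i).
  by rewrite mulr_sumr; apply: eq_bigr => i _; rewrite mulrA.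
Qed.

Lemma gen_ideal_mem s i : (i < size s)%N -> gen_ideal s s`_i.
Proof.
move=> lis; exists (fun j => (j == i)%:R).
rewrite (bigD1 (Ordinal lis)) //= eqxx mul1r big1 ?addr0 // => j nji.
by rewrite -val_eqE /= in nji; rewrite (negPf nji) mul0r.
Qed.

Lemma gen_ideal_sub s L : is_ideal L ->
  (forall i, (i < size s)%N -> L s`_i) -> subI (gen_ideal s) L.
Proof. by move=> IL Ls _ [c ->]; apply: ideal_sum => // i _; apply: ideal_mull => //;
  apply: Ls. Qed.

Lemma mulI_mem I J x y : I x -> J y -> mulI I J (x * y).
Proof.
move=> Ix Jy; exists [:: (x, y)]; rewrite big_seq1; split=> // p.
by rewrite inE => /eqP->.
Qed.

Lemma mulI_ideal I J : is_ideal J -> is_ideal (mulI I J).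
Proof.
move=> IJ; split.
- by exists [::]; rewrite big_nil.
- move=> _ _ [s [Hs ->]] [t [Ht ->]]; exists (s ++ t); rewrite big_cat; split=> // p.
  by rewrite mem_cat => /orP[/Hs|/Ht].
- move=> r _ [s [Hs ->]]; exists [seq (p.1, r * p.2) | p <- s]; split.
    by move=> _ /mapP[p /Hs[Ip Jp] ->]; split=> //=; apply: ideal_mull.
  by rewrite big_map mulr_sumr; apply: eq_bigr => p _; rewrite mulrCA.
Qed.

Lemma mulI_sub I J L : is_ideal L ->
  (forall x y, I x -> J y -> L (x * y)) -> subI (mulI I J) L.
Proof.
move=> IL HL _ [s [Hs ->]]; rewrite big_seq; apply: ideal_sum => // p /Hs[].
exact: HL.
Qed.

Lemma powI_ideal I d : is_ideal (powI I d).
Proof. by elim: d => [|d IH]; [split | apply: mulI_ideal]. Qed.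

Lemma powI_mul I d e x y : powI I d x -> powI I e y -> powI I (d + e) (x * y).
Proof.
elim: d x => [|d IH] x Hx Hy; first by rewrite add0n; apply: ideal_mull => //; apply: powI_ideal.
(* Passing to the colon ideal [L] turns the claim into an inclusion, which is checked on products
   only. *)
pose L z := powI I (d.+1 + e) (z * y).
suff: subI (powI I d.+1) L by apply.
apply: mulI_sub => [|u v Iu Iv]; last by rewrite /L -mulrA; apply: mulI_mem => //; apply: IH.
split=> [|u v Hu Hv|r u Hu]; rewrite /L.
- by rewrite mul0r; exact: (ideal_zero (powI_ideal _ _)).
- by rewrite mulrDl; apply: ideal_add => //; apply: powI_ideal.
- by rewrite -mulrA; apply: ideal_mull => //; apply: powI_ideal.
Qed.

Lemma mulI_powI I J d e x y :
  mulI J (powI I d) x -> powI I e y -> mulI J (powI I (d + e)) (x * y).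
Proof.
move=> Hx Hy; pose L z := mulI J (powI I (d + e)) (z * y).
have Id := mulI_ideal J (powI_ideal I (d + e)).
suff: subI (mulI J (powI I d)) L by apply.
apply: mulI_sub => [|u v Ju Iv]; last by rewrite /L -mulrA; apply: mulI_mem => //; apply: powI_mul.
split=> [|u v Hu Hv|r u Hu]; rewrite /L.
- by rewrite mul0r; exact: ideal_zero.
- by rewrite mulrDl; apply: ideal_add.
- by rewrite -mulrA; apply: ideal_mull.
Qed.

Lemma powI1 I x : I x -> powI I 1 x.
Proof. by move=> Ix; rewrite -[x]mulr1; apply: mulI_mem. Qed.

Lemma powIX I d x : I x -> powI I d (x ^+ d).
Proof. by move=> Ix; elim: d => // d IH; rewrite exprS; apply: mulI_mem. Qed.

Lemma powI_prod I (f : seq R) : {in f, forall x, I x} ->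
  powI I (size f) (\prod_(x <- f) x).
Proof.
elim: f => [|x f IH] If; first by rewrite big_nil.
rewrite big_cons; apply: mulI_mem; first by apply: If; rewrite mem_head.
by apply: IH => y fy; apply: If; rewrite inE fy orbT.
Qed.

Lemma mulI_powI_sub I J d : subI J I -> subI (mulI J (powI I d)) (powI I d.+1).
Proof.
move=> JI; apply: mulI_sub => [|x y Jx Iy]; first exact: powI_ideal.
by apply: mulI_mem => //; apply: JI.
Qed.

Lemma powI_gen_sub s d L : is_ideal L ->
  (forall f : seq 'I_(size s), size f = d -> L (\prod_(i <- f) s`_i)) ->
  subI (powI (gen_ideal s) d) L.
Proof.
elim: d L => [|d IH] L IL HL x; first by move=> _; rewrite -[x]mulr1; apply: ideal_mull => //;
  have := HL [::] erefl; rewrite big_nil.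
apply: mulI_sub => // _ z [c ->] Hz; rewrite mulr_suml; apply: ideal_sum => // i _.
rewrite -mulrA; apply: ideal_mull => //; move: z Hz.
apply: (IH (fun z => L (s`_i * z))).
  split=> [|u v Hu Hv|r u Hu]; first by rewrite mulr0; apply: ideal_zero.
    by rewrite mulrDr; apply: ideal_add.
  by rewrite mulrCA; apply: ideal_mull.
by move=> f sf; have := HL (i :: f); rewrite big_cons /= sf; apply.
Qed.

(* In a monomial of degree greater than (size s) * k, some generator occurs at least k times. *)
Lemma powI_gen_pigeonhole s k d L : is_ideal L -> (size s * k < d)%N ->
  (forall (i : 'I_(size s)) z, powI (gen_ideal s) (d - k) z -> L (s`_i ^+ k * z)) ->
  subI (powI (gen_ideal s) d) L.
Proof.
move=> IL ltd HL; apply: powI_gen_sub => // f sf.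
have [i leki] : exists i, (k <= count_mem i f)%N.
  apply/existsP; apply: contraLR ltd; rewrite negb_exists => /forallP H.
  rewrite -leqNgt -sf; have <- : (\sum_i count_mem i f = size f)%N.
    rewrite -[RHS]sum1_size [RHS](partition_big id predT) //=; apply: eq_bigr => i _.
    by rewrite -sum1_count; apply: eq_bigl => j.
  apply: (@leq_trans (\sum_(i < size s) k)); last by rewrite sum_nat_const card_ord.
  by apply: leq_sum => j _; apply: ltnW; rewrite ltnNge.
pose g := nseq (count_mem i f - k) i ++ filter (predC1 i) f.
have pf : perm_eq f (nseq k i ++ g).
  rewrite /g catA -nseqD subnKC // -(perm_filterC (pred1 i)) perm_cat2r.
  by rewrite (all_pred1P _ _ (filter_all _ _)) size_filter perm_refl.
rewrite (perm_big _ pf) big_cat big_nseq.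
rewrite (_ : iter _ _ _ = s`_i ^+ k); last first.
  by elim: (k) => //= l ->; rewrite exprS.
apply: HL; have -> : (d - k)%N = size [seq s`_(val j) | j <- g].
  by rewrite size_map -sf (perm_size pf) size_cat size_nseq addKn.
rewrite -[X in powI _ _ X](big_map (fun j : 'I__ => s`_j) predT id).
by apply: powI_prod => _ /mapP[j _ ->]; exact: (gen_ideal_mem (ltn_ord j)).
Qed.

(** Otherwise choice iterates strictly larger members into a chain. Its union is finitely generated,
    so all generators lie in one stage, and the next stage cannot be larger. *)
Lemma noetherian_maximal (F : (R -> Prop) -> Prop) I0 : noetherian R ->
  (forall I, F I -> is_ideal I) -> F I0 ->
  exists2 I, F I & forall J, F J -> subI I J -> subI J I.
Proof.
move=> noe FI F0; apply: contrapT => nomax.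
have /choice [nx Hnx] (I : R -> Prop) : exists J, F I -> [/\ F J, subI I J & ~ subI J I].
  have [FII|] := pselect (F I); last by exists I.
  apply: contrapT => nJ; apply: nomax; exists I => // J FJ IJ.
  by apply: contrapT => nJI; apply: nJ; exists J.
pose C k := iter k nx I0.
have FC k : F (C k) by elim: k => //= k /Hnx[].
have CS k l : (k <= l)%N -> subI (C k) (C l).
  move=> /subnK<-; elim: (l - k)%N => //= e IH x /IH.
  by have [_ + _] := Hnx _ (FC (e + k)%N); apply.
pose U x := exists k, C k x.
have IU : is_ideal U.
  split=> [|x y [k Hk] [l Hl]|r x [k Hk]]; first by exists 0%N; exact: (ideal_zero (FI _ F0)).
    exists (maxn k l); apply: ideal_add; first exact: FI.
    - by apply: CS Hk; apply: leq_maxl.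
    - by apply: CS Hl; apply: leq_maxr.
  by exists k; apply: ideal_mull => //; apply: FI.
have [s Us] := noe U IU.
have [k Ck] : exists k, forall i, (i < size s)%N -> C k s`_i.
  have /choice [h Hh] (i : 'I_(size s)) : exists k, C k s`_i.
    by have /Us := gen_ideal_mem (ltn_ord i).
  exists (\max_i h i)%N => i lis; apply: CS (Hh (Ordinal lis)).
  exact: (@leq_bigmax _ h (Ordinal lis)).
have [_ _] := Hnx _ (FC k); apply => x Hx.
apply: (gen_ideal_sub (FI _ (FC k)) Ck); apply/Us.
by exists k.+1.
Qed.

End Ideals.

(** * Local Noetherian rings with finite residue field *)

Section LocalRing.
Local Open Scope ring_scope.
Variables (R : comNzRingType) (m : R -> Prop).
Hypotheses (noe : noetherian R) (locm : local_with m).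

Lemma local_ideal : is_ideal m. Proof. by case: locm => [[]]. Qed.

Lemma local1 : ~ m 1. Proof. by case: locm => [[]]. Qed.

Lemma local_unit x : ~ m x -> exists y, x * y = 1.
Proof.
move=> mx; apply: contrapT => nux.
pose F I := [/\ is_ideal I, ~ I 1 & I x].
have [||M [IM M1 Mx] maxM] := @noetherian_maximal R F (gen_ideal [:: x]) noe.
- by move=> I [].
- split; [exact: gen_ideal_ideal | | exact: (@gen_ideal_mem _ [:: x] 0)].
  by move=> [c]; rewrite big_ord1 => e; apply: nux; exists (c 0%N); rewrite mulrC e.
case: locm => _ /(_ M) /(_ _ x)[|/(_ Mx)] //; split=> // I II MI.
have [I1|I1] := pselect (I 1); [by right | left => y; split; last exact: MI].
by apply: maxM => //; split=> //; apply: MI.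
Qed.

Lemma local_prime x y : m (x * y) -> m x \/ m y.
Proof.
have [mx|/local_unit[z xz]] := pselect (m x); [by left | move=> mxy; right].
by rewrite -[y]mul1r -xz mulrAC; apply: (ideal_mulr _ local_ideal).
Qed.

Lemma prime_sub_local P : prime_ideal P -> subI P m.
Proof.
move=> [IP P1 _] x Px; apply: contrapT => /local_unit[y xy]; apply: P1.
by rewrite -xy; apply: ideal_mulr.
Qed.

(** An ideal maximal among those containing [I0] and disjoint from [S] is prime: for [x], [y]
    outside [P], both P + Rx and P + Ry meet [S], and the product of the two elements found would
    lie in [P] if [x * y] did. *)
Lemma exists_prime_disjoint (S I0 : R -> Prop) : S 1 ->
  (forall x y, S x -> S y -> S (x * y)) -> is_ideal I0 ->
  (forall x, I0 x -> ~ S x) ->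
  exists P, [/\ prime_ideal P, subI I0 P & forall x, P x -> ~ S x].
Proof.
move=> S1 SM II0 dI0.
pose F I := [/\ is_ideal I, subI I0 I & forall x, I x -> ~ S x].
have [||P [IP I0P dP] maxP] := @noetherian_maximal R F I0 noe; [by move=> I [] | by split |].
exists P; split=> //; split=> [//|/dP/(_ S1)//|x y Pxy].
have big z : ~ P z -> exists p r, P p /\ S (p + r * z).
  move=> Pz; apply: contrapT => noS.
  pose I u := exists p r, P p /\ u = p + r * z.
  have PI : subI P I by move=> u Pu; exists u, 0; rewrite mul0r addr0.
  apply: Pz; apply: (maxP I) => //; last by exists 0, 1; rewrite mul1r add0r; split=> //;
    apply: ideal_zero.
  split; last 1 first.
  - by move=> u [p [r [Pp ->]]] Su; apply: noS; exists p, r.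
  - split.
    + exact: (PI _ (ideal_zero IP)).
    + move=> _ _ [p [r [Pp ->]]] [p' [r' [Pp' ->]]]; exists (p + p'), (r + r').
      by split; [apply: ideal_add | ring].
    + move=> a _ [p [r [Pp ->]]]; exists (a * p), (a * r).
      by split; [apply: ideal_mull | ring].
  - by move=> u /I0P/PI.
have [Px|/big[p [r [Pp Sx]]]] := pselect (P x); first by left.
have [Py|/big[p' [r' [Pp' Sy]]]] := pselect (P y); first by right.
have []:= dP _ _ (SM _ _ Sx Sy).
have -> : (p + r * x) * (p' + r' * y) =
  (p' + r' * y) * p + (r * x) * p' + (r * r') * (x * y) by ring.
by apply: ideal_add => //; [apply: ideal_add => // |]; apply: ideal_mull.
Qed.

(* A prime over c that missed a power of x would lie strictly between m and a
   smaller prime avoiding c. *)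
Lemma nzd_red_radical c x : krull_dim_one R -> nzd_red c -> m x ->
  exists k r, x ^+ k = c * r.
Proof.
move=> [_ nochain] cnzd mx; apply: contrapT => nopow.
have [||||P [pP cP xP]] := @exists_prime_disjoint (fun y => exists k, y =
  x ^+ k) (gen_ideal [:: c]).
- by exists 0%N.
- by move=> _ _ [k ->] [l ->]; exists (k + l)%N; rewrite exprD.
- exact: gen_ideal_ideal.
- by move=> _ [d ->] [k e]; apply: nopow; exists k, (d 0%N); rewrite -e big_ord1 mulrC.
have Pc : P c by apply: cP; exact: (@gen_ideal_mem _ [:: c] 0).
have [IP P1 prP] := pP.
(* This multiplicative set omits 0 because [c] is a non-zero-divisor modulo nilpotents. A prime
   disjoint from it lies in [P] and omits [c]. *)
have [||||Q [pQ _ dQ]] := @exists_prime_disjoint (fun y => exists k s, ~ P s /\ y =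
  c ^+ k * s) (fun y => y = 0).
- by exists 0%N, 1; rewrite mulr1.
- move=> _ _ [k [s [Ps ->]]] [l [t [Pt ->]]]; exists (k + l)%N, (s * t).
  by split; [move/prP => [] | rewrite exprD; ring].
- by split=> [//|x1 y1 -> ->|r x1 ->]; rewrite ?addr0 ?mulr0.
- move=> _ -> [k [s [Ps e]]]; apply: (Ps).
  have [l sl] : nilpotent_el s.
    apply: cnzd; exists k.+1; have -> : (s * c) ^+ k.+1 = c ^+ k * s * (c * s ^+ k).
      by rewrite exprMn !exprS; ring.
    by rewrite -e mul0r.
  have {sl} : P (s ^+ l) by rewrite sl; apply: ideal_zero.
  by elim: l => [//|l IH]; rewrite exprS => /prP[].
apply: nochain; exists Q, P, m; split=> //.
- by split; [exact: local_ideal | exact: local1 | exact: local_prime].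
- split=> [y Qy|sPQ]; first by apply: contrapT => Py; apply: (dQ y) => //; exists 0%N, y;
  rewrite mul1r.
  by apply: (dQ c); [exact: sPQ | exists 1%N, 1; rewrite expr1 mulr1].
- split; first exact: prime_sub_local.
  by move=> /(_ _ mx) Px; apply: (xP x) => //; exists 1%N; rewrite expr1.
Qed.

Variable q : nat.
Hypothesis resq : residue_card m q.

Lemma residue_card_gt1 : (1 < q)%N.
Proof.
case: resq => s [sq inj sur].
have [i li mi] := sur 0; have [j lj mj] := sur 1.
rewrite ltnNge; apply/negP => leq1.
have eij : i = j by lia.
apply: local1; have -> : 1 = (1 - s`_j) - (0 - s`_i) by rewrite eij; ring.
by apply: ideal_sub => //; apply: local_ideal.
Qed.

(** A representative modulo [m] leaves an element of [m]; writing it in generators of [m] and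
    rounding the coefficients gains one power. [phi] meets every class, possibly more than once. *)
Lemma finite_mod_powI t : exists (X : finType) (phi : X -> R),
  forall x, exists i, powI m t (x - phi i).
Proof.
have [a ma] := noe local_ideal; case: resq => s [sq _ sur].
elim: t => [|t [X [phi Hphi]]]; first by exists unit, (fun=> 0) => x; exists tt.
exists ('I_q * {ffun 'I_(size a) -> X})%type,
  (fun p : 'I_q * {ffun 'I_(size a) -> X} => s`_(p.1) + \sum_(j < size a) phi (p.2 j) * a`_j) => x.
have [i li mi] := sur x; have /ma[c ec] := mi.
have /choice[f Hf] (j : 'I_(size a)) := Hphi (c j).
exists (Ordinal li, [ffun j => f j]) => /=.
have -> : x - (s`_i + \sum_(j < size a) phi ([ffun j => f j] j) * a`_j) =
          \sum_(j < size a) a`_j * (c j - phi (f j)).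
  rewrite opprD addrA ec -sumrB; apply: eq_bigr => j _; rewrite ffunE; ring.
apply: ideal_sum => [|j _]; first exact: (powI_ideal _ t.+1).
by apply: mulI_mem => //; apply/ma; apply: gen_ideal_mem.
Qed.

(** Each generator of [m] has a power in (c), so by pigeonhole on monomials some power of [m] lies
    in (c). *)
Lemma finite_mod_nzd_red c : krull_dim_one R -> nzd_red c ->
  exists (X : finType) (phi : X -> R), forall x, exists i w, x = phi i + c * w.
Proof.
move=> dim1 cnzd; have [a ma] := noe local_ideal.
have em : m = gen_ideal a by apply/funext => x; apply/propext; apply: ma.
have /choice[k Hk] (j : 'I_(size a)) : exists k, exists r, a`_j ^+ k = c * r.
  by apply: nzd_red_radical => //; apply/ma; apply: gen_ideal_mem.
have subc : subI (powI m (size a * \max_j k j).+1) (gen_ideal [:: c]).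
  rewrite em; apply: powI_gen_pigeonhole (ltnSn _) _ => [|j z _]; first exact: gen_ideal_ideal.
  apply: (ideal_mulr _ (gen_ideal_ideal _)); have [r e] := Hk j.
  rewrite -(subnK (leq_bigmax j)) exprD e mulrA mulrAC.
  by apply: (ideal_mull _ (gen_ideal_ideal _)); exact: (@gen_ideal_mem _ [:: c] 0).
have [X [phi Hphi]] := finite_mod_powI (size a * \max_j k j).+1.
exists X, phi => x; have [i /subc[d]] := Hphi x.
by rewrite big_ord1 /= => e; exists i, (d 0%N); rewrite mulrC -e addrC subrK.
Qed.

(* Otherwise the products c^i x^j would be so independent modulo m that their
   combinations outgrow the quotients R/(c^N). *)
Lemma homogeneous_relation (X : finType) (phi : X -> R) x c : m x -> m c ->
  (forall y, exists i w, y = phi i + c * w) ->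
  exists d (r : nat -> R), (exists2 j, (j <= d)%N & ~ m (r j)) /\
    \sum_(j < d.+1) r j * (x ^+ j * c ^+ (d - j)) = 0.
Proof.
move=> mx mc Hphi; have Im := local_ideal.
case: resq => s [sq inj sur].
(* The first [N] digits of [y] in base [c], with digits taken from [X]. *)
have expand N y : exists (h : {ffun 'I_N -> X}) w,
    y = \sum_(l < N) c ^+ l * phi (h l) + c ^+ N * w.
  elim: N => [|N [h [w ->]]].
    have [i _] := Hphi 0.
    by exists [ffun=> i], y; rewrite big_ord0 add0r mul1r.
  have [i [v ->]] := Hphi w.
  exists [ffun l : 'I_N.+1 => if insub (val l) is Some l' then h l' else i], v.
  rewrite big_ord_recr /= ffunE insubF ?ltnn // exprSr mulrDr !mulrA addrA.
  congr (_ + _ + _); apply: eq_bigr => l _; rewrite ffunE /= insubT //= => lN.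
  by congr (_ * phi (h _)); apply/val_inj.
(* With n = 2B there are q^(n n) = (q^B)^(2n) coefficient arrays but only B^(2n) digit strings of
   length 2n, so two arrays share their digits. *)
pose B := #|X|; pose n := B.*2; pose ix := ('I_n * 'I_n)%type.
have B0 : (0 < B)%N by have [i _] := Hphi 0; apply/card_gt0P; exists i.
pose value (F : {ffun ix -> 'I_q}) := \sum_(p : ix) s`_(F p) * (c ^+ p.1 * x ^+ p.2).
have /choice[H HH] F := expand n.*2 (value F).
have [F [F' [nFF' eH]]] : exists F F', F <> F' /\ H F = H F'.
  apply: contrapT => noF.
  have /leq_card : injective H by move=> F F' e; apply: contrapT => nF; apply: noF; exists F, F'.
  rewrite !card_ffun !card_prod !card_ord -/B => le.
  have lt1 : (B < q ^ B)%N by apply: ltn_expl; apply: residue_card_gt1.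
  have := ltn_exp2r B (q ^ B) (_ : 0 < n.*2)%N; rewrite -!expnM lt1 => /(_ _).
  have -> : (B * n.*2 = n * n)%N by rewrite /n; lia.
  by move=> /(_ ltac:(rewrite /n; lia)); lia.
have [w Hw] : exists w, value F - value F' = c ^+ n.*2 * w.
  have [w ->] := HH F; have [w' ->] := HH F'; rewrite eH.
  by exists (w - w'); ring.
pose dl (i j : nat) := if insub i is Some i' then if insub j is Some j' then
   s`_(F (i', j')) - s`_(F' (i', j')) else 0 else 0 : R.
have dlE (p : ix) : dl p.1 p.2 = s`_(F p) - s`_(F' p).
  by rewrite /dl !valK; case: p.
have dl0 i j : m (dl i j) -> dl i j = 0.
  rewrite /dl; case: insubP => // i' _ _; case: insubP => // j' _ _ ms.
  by rewrite (inj _ _ (ltn_ord _) (ltn_ord _) ms) subrr.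
have exd : exists d, [exists p : ix, (p.1 + p.2 == d)%N && (F p != F' p)].
  have [p np] : exists p, F p != F' p.
    apply: contrapT => np; apply: nFF'; apply/ffunP => p; apply/eqP.
    by apply: contrapT => /negP nFp; apply: np; exists p.
  by exists (p.1 + p.2)%N; apply/existsP; exists p; rewrite eqxx.
(* [d] is the lowest total degree in which the two arrays differ. *)
case: (ex_minnP exd) => d /existsP[[i0 j0] /andP[/= /eqP ed nF0]] mind.
(* Error terms: forms of degree [d] in [x] and [c] with coefficients in [m]. Monomials of higher
   degree belong here too, since a surplus factor [x] or [c] lies in [m]. *)
pose G z := exists r : nat -> R, (forall j, m (r j)) /\ z =
  \sum_(j < d.+1) r j * (x ^+ j * c ^+ (d - j)).
have G0 : G 0.
  exists (fun=> 0); split=> [_|]; first exact: ideal_zero.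
  by rewrite big1 // => j _; rewrite mul0r.
have IG : is_ideal G.
  split=> // [_ _ [r [mr ->]] [r' [mr' ->]]|a _ [r [mr ->]]].
    exists (fun j => r j + r' j); split=> [j|]; first exact: ideal_add.
    by rewrite -big_split; apply: eq_bigr => j _; rewrite mulrDl.
  exists (fun j => a * r j); split=> [j|]; first exact: ideal_mull.
  by rewrite mulr_sumr; apply: eq_bigr => j _; rewrite mulrA.
have Gmon u j : (j <= d)%N -> m u -> G (u * (x ^+ j * c ^+ (d - j))).
  move=> lejd mu; exists (fun l => if l == j then u else 0); split=> [l|].
    by case: ifP => // _; apply: ideal_zero.
  rewrite (bigD1 (Ordinal (lejd : (j < d.+1)%N))) //= eqxx big1 ?addr0 // => l nl.
  by rewrite -val_eqE /= in nl; rewrite (negPf nl) mul0r.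
have Ghigh i j : (d < i + j)%N -> G (c ^+ i * x ^+ j).
  move=> ltd; have [led|ltj] := leqP j d.
    have -> : c ^+ i * x ^+ j = c ^+ (i + j - d).-1 * (c * (x ^+ j * c ^+ (d - j))).
      have {1}-> : i = ((i + j - d).-1 + (1 + (d - j)))%N by lia.
      by rewrite !exprD expr1; ring.
    by apply: ideal_mull => //; apply: Gmon.
  have -> : c ^+ i * x ^+ j = c ^+ i * x ^+ (j - d).-1 * (x * (x ^+ d * c ^+ (d - d))).
    have -> : x ^+ j = x ^+ ((j - d).-1 + (1 + d)) by congr (_ ^+ _); lia.
    by rewrite !exprD subnn; ring.
  by apply: ideal_mull => //; apply: Gmon.
have ltd2 : (d < n.*2)%N by have := ltn_ord i0; have := ltn_ord j0; lia.
(* The degree-d part is the whole difference, divisible by c^(2n) with 2n > d, minus the other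
   degrees: lower ones vanish by minimality of [d], higher ones lie in [G]. *)
have Glow : G (\sum_(p : ix | (p.1 + p.2 == d)%N) dl p.1 p.2 * (c ^+ p.1 * x ^+ p.2)).
  have -> : \sum_(p : ix | (p.1 + p.2 == d)%N) dl p.1 p.2 * (c ^+ p.1 * x ^+ p.2) =
     w * (c ^+ n.*2 * x ^+ 0) - \sum_(p : ix | (p.1 + p.2 != d)%N) dl p.1 p.2 * (c ^+ p.1 * x ^+
       p.2).
    have tot : \sum_(p : ix) dl p.1 p.2 * (c ^+ p.1 * x ^+ p.2) = w * (c ^+ n.*2 * x ^+ 0).
      rewrite mulr1 mulrC -Hw /value -sumrB; apply: eq_bigr => p _.
      by rewrite dlE mulrBl.
    apply/eqP; rewrite eq_sym subr_eq -tot.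
    by rewrite (bigID (fun p : ix => p.1 + p.2 == d)%N).
  apply: ideal_sub => //; first by apply: ideal_mull => //; apply: Ghigh; rewrite addn0.
  apply: ideal_sum => // p npd.
  have [ltp|gtp] := ltnP (p.1 + p.2)%N d; last by apply: ideal_mull => //; apply: Ghigh;
    rewrite ltn_neqAle eq_sym npd.
  rewrite dlE; have -> : F p = F' p.
    apply/eqP; apply: contraTT ltp => nFp; rewrite -leqNgt.
    by apply: mind; apply/existsP; exists p; rewrite eqxx.
  by rewrite subrr mul0r.
case: Glow => r [mr er].
(* Absorbing the error changes coefficients only by elements of [m], and at [j0] the two arrays
   differ modulo [m]. *)
exists d, (fun j => dl (d - j)%N j - r j); split.
  exists (val j0); first by rewrite -ed leq_addl.
  move=> md; have /dl0 : m (dl (d - j0)%N j0) by rewrite -[dl _ _](subrK (r j0)); apply: ideal_add.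
  rewrite -ed addnK (dlE (i0, j0)) => e0.
  move/eqP: nF0; apply; apply/val_inj; apply: inj; rewrite ?ltn_ord // e0.
  exact: ideal_zero.
under eq_bigr do rewrite mulrBl.
rewrite sumrB -er; apply/eqP; rewrite subr_eq0; apply/eqP.
(* Sort the pairs by the exponent of [x]. In degree [d] at most one pair has exponent [j], and [dl]
   is 0 when that pair is out of range. *)
rewrite (partition_big (fun p : ix => inord (val p.2) : 'I_d.+1) predT) //=.
apply: eq_bigr => j _.
have [/andP[ltj ltdj]|out] := boolP ((j < n) && (d - j < n))%N.
  rewrite (big_pred1 (Ordinal ltdj, Ordinal ltj)) /= => [|[i' j']].
    by rewrite [c ^+ _ * _]mulrC.
  rewrite /= xpair_eqE -!val_eqE /=; have := ltn_ord j.
  case: eqP => [e|ne] /=; last by lia.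
  by rewrite inordK; lia.
rewrite big1 => [|[i' j'] /=].
  by rewrite /dl; case: insubP => [u ui _|]; [case: insubP => [v vi _|] |]; rewrite ?mul0r //;
    move: out; rewrite ui vi.
move=> /andP[/eqP e /eqP /(congr1 val)]; rewrite /= inordK; last by lia.
by have := ltn_ord i'; have := ltn_ord j'; lia.
Qed.

End LocalRing.

(** * The integral closure and its maximal ideals *)

Section IntegralClosure.
Local Open Scope ring_scope.
Variables (R T : comNzRingType) (g : {rmorphism R -> T}).
Notation A := (integral_el g).
Implicit Types (I M D : T -> Prop).

Lemma integral_elE t : A t <-> integralOver g t.
Proof. by split=> [[p [mp /eqP rp]]|[p mp /eqP rp]]; exists p. Qed.

Lemma integral_el_id x : A (g x).
Proof. exact/integral_elE/integral_id. Qed.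

Lemma integral_el0 : A 0. Proof. by rewrite -(rmorph0 g); apply: integral_el_id. Qed.

Lemma integral_el1 : A 1. Proof. by rewrite -(rmorph1 g); apply: integral_el_id. Qed.

Lemma integral_elD x y : A x -> A y -> A (x + y).
Proof. by move=> /integral_elE ? /integral_elE ?; apply/integral_elE/integral_add. Qed.

Lemma integral_elB x y : A x -> A y -> A (x - y).
Proof. by move=> /integral_elE ? /integral_elE ?; apply/integral_elE/integral_sub. Qed.

Lemma integral_elM x y : A x -> A y -> A (x * y).
Proof. by move=> /integral_elE ? /integral_elE ?; apply/integral_elE/integral_mul. Qed.

Lemma integral_el_sum (X : Type) (r : seq X) (P : pred X) (F : X -> T) :
  (forall i, P i -> A (F i)) -> A (\sum_(i <- r | P i) F i).
Proof. by move=> AF; elim/big_ind: _ => // *; [exact: integral_el0|exact: integral_elD]. Qed.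

Lemma integral_el_prod (X : Type) (r : seq X) (P : pred X) (F : X -> T) :
  (forall i, P i -> A (F i)) -> A (\prod_(i <- r | P i) F i).
Proof. by move=> AF; elim/big_ind: _ => // *; [exact: integral_el1|exact: integral_elM]. Qed.

Lemma integral_elX x k : A x -> A (x ^+ k).
Proof.
by move=> Ax; elim: k => [|k IH]; [exact: integral_el1 | rewrite exprS; apply: integral_elM].
Qed.

Lemma integral_el_root p t : p \is monic -> root p t -> (forall i, A p`_i) -> A t.
Proof.
move=> mp rp Ap; apply/integral_elE; apply: integral_root_monic mp rp _.
by apply/integral_poly => i; apply/integral_elE.
Qed.

(* The equation for t, multiplied by (c d) ^+ d.-1, is a monic one for c d * t. *)
Lemma integral_lead_mul d (c : nat -> T) t : (forall i, A (c i)) -> (0 < d)%N ->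
  \sum_(i < d.+1) c i * t ^+ i = 0 -> A (c d * t).
Proof.
move=> Ac; case: d => // d _ e.
pose q := \poly_(i < d.+1) (c i * c d.+1 ^+ (d - i)).
have sq : (size q < size ('X^(d.+1) : {poly T}))%N by rewrite size_polyXn ltnS size_poly.
apply: (@integral_el_root ('X^(d.+1) + q)).
- by rewrite monicE lead_coefDl ?lead_coefXn.
- rewrite rootE hornerD hornerXn horner_poly; apply/eqP.
  have := congr1 (fun z => c d.+1 ^+ d * z) e; rewrite mulr0 => e0; rewrite -[RHS]e0.
  rewrite [in RHS]big_ord_recr /= mulrDr [RHS]addrC mulr_sumr; congr (_ + _).
    by rewrite exprMn [c d.+1 ^+ d.+1]exprSr; ring.
  apply: eq_bigr => i _; rewrite exprMn.
  have -> : c d.+1 ^+ d = c d.+1 ^+ (d - i) * c d.+1 ^+ i by rewrite -exprD subnK // -ltnS.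
  by ring.
move=> i; rewrite coefD coefXn coef_poly; apply: integral_elD.
  by case: (_ == _); [exact: integral_el1|exact: integral_el0].
case: ifP => _; last exact: integral_el0.
by apply: integral_elM => //; apply: integral_elX.
Qed.

Lemma closure_ideal_sum I (X : Type) (r : seq X) (P : pred X) (F : X -> T) :
  closure_ideal g I -> (forall i, P i -> I (F i)) -> I (\sum_(i <- r | P i) F i).
Proof. by move=> [_ I0 ID _] IF; elim/big_ind: _ => // *; apply: ID. Qed.

Lemma closure_idealN I x : closure_ideal g I -> I x -> I (- x).
Proof.
move=> [_ _ _ IM] Ix; rewrite -mulN1r; apply: IM => //.
by rewrite -[-1]add0r; apply: integral_elB; [exact: integral_el0|exact: integral_el1].
Qed.

Lemma closure_idealB I x y : closure_ideal g I -> I x -> I y -> I (x - y).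
Proof. by move=> cI Ix /(closure_idealN cI) Iy; case: cI => _ _ ID _; apply: ID. Qed.

Lemma closure_maximal_comaximal M I : closure_maximal g M -> closure_ideal g I ->
  ~ (forall x, I x -> M x) -> exists mu y, [/\ M mu, I y & mu + y = 1].
Proof.
move=> [cM M1 maxM] cI nIM.
pose K u := exists mu y, [/\ M mu, I y & mu + y = u].
have [MA M0 MD MM] := cM; have [IA I0 ID IM] := cI.
have [||eK|//] := maxM K; last by case: nIM => x Ix; apply/eK; exists 0, x; rewrite add0r.
  split=> [_ [u [v [Mu Iv <-]]]| |_ _ [u [v [Mu Iv <-]]] [u' [v' [Mu' Iv' <-]]]|r _ Ar [u [v [Mu
    Iv <-]]]].
  - by apply: integral_elD; [apply: MA|apply: IA].
  - by exists 0, 0; rewrite addr0.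
  - by exists (u + u'), (v + v'); split; [apply: MD|apply: ID|ring].
  - by exists (r * u), (r * v); split; [apply: MM|apply: IM|ring].
by move=> x Mx; exists x, 0; rewrite addr0.
Qed.

Lemma closure_maximal_inv M x : closure_maximal g M -> A x -> ~ M x ->
  exists2 y, A y & M (x * y - 1).
Proof.
move=> maxM Ax Mx; have cM : closure_ideal g M by case: maxM.
have [||mu [_ [Mmu [y [Ay ->]] e]]] := @closure_maximal_comaximal M (fun u => exists y, A y /\ u
  = x * y) maxM.
- split=> [_ [y [Ay ->]]| |_ _ [y [Ay ->]] [z [Az ->]]|r _ Ar [y [Ay ->]]].
  + exact: integral_elM.
  + by exists 0; rewrite mulr0; split=> //; apply: integral_el0.
  + by exists (y + z); rewrite mulrDr; split=> //; apply: integral_elD.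
  + by exists (r * y); rewrite mulrCA; split=> //; apply: integral_elM.
- by move=> H; apply/Mx/H; exists 1; rewrite mulr1; split=> //; apply: integral_el1.
exists y => //; rewrite -e opprD addrCA subrr addr0.
exact: closure_idealN.
Qed.

Lemma closure_maximal_prime M x y : closure_maximal g M -> A x -> A y ->
  M (x * y) -> M x \/ M y.
Proof.
move=> maxM Ax Ay Mxy; have [Mx|Mx] := pselect (M x); [by left|right].
have cM : closure_ideal g M by case: maxM.
have [z Az Mz] := closure_maximal_inv maxM Ax Mx.
have -> : y = z * (x * y) - y * (x * z - 1) by ring.
by case: (cM) => _ _ _ MM; apply: closure_idealB => //; apply: MM.
Qed.

Lemma closure_maximal_notin_mul M x y : closure_maximal g M -> A x -> A y ->
  ~ M x -> ~ M y -> ~ M (x * y).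
Proof. by move=> maxM Ax Ay Mx My /(closure_maximal_prime maxM Ax Ay)[]. Qed.

Lemma closure_maximal_notin_exp M x k : closure_maximal g M -> A x ->
  ~ M x -> ~ M (x ^+ k).
Proof.
move=> maxM Ax Mx; elim: k => [|k IH]; first by case: maxM.
by rewrite exprS; apply: closure_maximal_notin_mul => //; apply: integral_elX.
Qed.

Lemma exists_closure_maximal D : closure_ideal g D -> ~ D 1 ->
  exists2 M, closure_maximal g M & forall x, D x -> M x.
Proof.
move=> cD D1.
pose Q (X : set T) := [/\ closure_ideal g X, ~ X 1 & forall x, D x -> X x].
have D0 : D 0 by case: cD.
have [F FP totF|M [[M0|[cM M1 DM]] maxM]] := @Zorn_bigcup T (fun X => X = set0 \/ Q X).
- have [[X [FX QX]]|noQ] := pselect (exists X, F X /\ Q X); last first.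
    left; rewrite -subset0 => x [X FX Xx].
    by have [X0|QX] := FP _ FX; [rewrite X0 in Xx|case: noQ; exists X].
  right; have QF Y y : F Y -> Y y -> Q Y by move=> /FP[->|].
  have [cX X1 DX] := QX.
  split; first split.
  + by move=> y [Y FY Yy]; have [[+ _ _ _] _ _] := QF _ _ FY Yy; apply.
  + by exists X => //; apply: DX.
  + move=> y z [Y FY Yy] [Z FZ Zz].
    have [[_ _ YD _] _ _] := QF _ _ FY Yy; have [[_ _ ZD _] _ _] := QF _ _ FZ Zz.
    by have [YZ|ZY] := totF _ _ FY FZ; [exists Z => //; apply: ZD => //; apply: YZ|
      exists Y => //; apply: YD => //; apply: ZY].
  + move=> r y Ar [Y FY Yy]; have [[_ _ _ YM] _ _] := QF _ _ FY Yy.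
    by exists Y => //; apply: YM.
  + by move=> [Y FY Y1]; have [_ + _] := QF _ _ FY Y1; apply.
  + by move=> x Dx; exists X => //; apply: DX.
- case: (maxM D); last by right.
  by rewrite M0; split=> [x []|/(_ _ D0)].
exists M => //; split=> // I cI MI.
have [I1|I1] := pselect (I 1); [by right|left=> x; split; last exact: MI].
apply: contrapT => /not_implyP[Ix Mx].
apply: (maxM I); first by split=> // /(_ _ Ix).
by right; split=> // y /DM/MI.
Qed.

(* While the leading coefficient c d and c d * t lie in M, fold the latter into
   the next coefficient, which does not change the class of that one modulo M. *)
Lemma closure_maximal_valuative M d (c : nat -> T) t : closure_maximal g M ->
  (forall i, A (c i)) -> \sum_(i < d.+1) c i * t ^+ i = 0 ->
  (exists2 i, (i <= d)%N & ~ M (c i)) ->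
  exists a, [/\ A a, A (a * t) & ~ (M a /\ M (a * t))].
Proof.
move=> maxM; have cM : closure_ideal g M by case: maxM.
have [MA M0 MD MM] := cM.
elim: d c => [|d IH] c Ac e [i led Mi].
  by move: led e Mi; rewrite leqn0 => /eqP->; rewrite big_ord1 mulr1 => ->.
have Aw := integral_lead_mul Ac (ltn0Sn d) e.
have [[Mc Mw]|nM] := pselect (M (c d.+1) /\ M (c d.+1 * t)); last by exists (c d.+1).
apply: (IH (fun i => if i == d then c d + c d.+1 * t else c i)).
- by move=> j; case: eqP => _ //; apply: integral_elD.
- rewrite -[RHS]e !big_ord_recr /= eqxx exprS -addrA; congr (_ + _); last by ring.
  by apply: eq_bigr => j _; rewrite ltn_eqF.
- exists i => [|/=].
    by rewrite leqNgt; apply/negP => ltdi; apply: Mi; have -> : i = d.+1 by lia.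
  case: eqP => // eid Mcd; apply: Mi.
  by rewrite eid -[c d](addrK (c d.+1 * t)); apply: closure_idealB.
Qed.

Variable m : R -> Prop.
Hypotheses (noe : noetherian R) (locm : local_with m).

(** If [al] inverts [g x] modulo [M], multiplying the monic equation of [al] by [g x ^+ d] shows
    that [g z] lies in [M]. But [z] is 1 plus an element of [m], hence a unit. *)
Lemma closure_maximal_contains M x : closure_maximal g M -> m x -> M (g x).
Proof.
move=> maxM mx; apply: contrapT => Mx.
have cM : closure_ideal g M by case: maxM.
have [MA M0 MD MM] := cM; have Im := local_ideal locm.
have [al Aal Mal] := closure_maximal_inv maxM (integral_el_id x) Mx.
have [p [mp]] := Aal; rewrite horner_coef size_map_poly_id0; last first.
  by rewrite (monicP mp) rmorph1 oner_neq0.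
have [d sp] : exists d, size p = d.+1.
  by exists (size p).-1; rewrite prednK // lt0n size_poly_eq0 monic_neq0.
have pd : p`_d = 1 by move/monicP: mp; rewrite /lead_coef sp.
rewrite sp => e.
have Mpow i : M ((g x * al) ^+ i - 1).
  elim: i => [|i IH]; first by rewrite subrr.
  have -> : (g x * al) ^+ i.+1 - 1 = (g x * al) ^+ i * (g x * al - 1) + ((g x * al) ^+ i - 1).
    by rewrite exprSr; ring.
  by apply: MD => //; apply: MM => //; apply/integral_elX/integral_elM => //; apply: integral_el_id.
pose z := \sum_(i < d.+1) p`_i * x ^+ (d - i).
have Mz : M (g z).
  have -> : g z =
    g x ^+ d * (\sum_(i < d.+1) (map_poly g p)`_i * al ^+ i) - \sum_(i < d.+1) g (p`_i * x ^+ (d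
      - i)) * ((g x * al) ^+ i - 1).
    rewrite rmorph_sum mulr_sumr -sumrB; apply: eq_bigr => i _.
    have -> : g x ^+ d = g x ^+ (d - i) * g x ^+ i by rewrite -exprD subnK // -ltnS.
    by rewrite coef_map rmorphM rmorphXn exprMn; ring.
  rewrite e mulr0; apply: closure_idealB => //; apply: closure_ideal_sum => // i _.
  by apply: MM => //; apply: integral_el_id.
have mz : ~ m z.
  rewrite /z big_ord_recr /= pd subnn mulr1 => mz; apply: (local1 locm).
  rewrite -[1](addKr (\sum_(i < d) p`_i * x ^+ (d - i))); apply: ideal_add => //.
  apply: ideal_opp => //; apply: ideal_sum => // i _; apply: ideal_mull => //.
  by apply: ideal_exp => //; rewrite subn_gt0.
have [y zy] := local_unit noe locm mz.
case: maxM => _ M1 _; apply: M1; rewrite -(rmorph1 g) -zy rmorphM mulrC.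
by apply: MM => //; apply: integral_el_id.
Qed.

Lemma closure_maximal_avoids M x : closure_maximal g M -> ~ m x -> ~ M (g x).
Proof.
move=> maxM /(local_unit noe locm)[y xy] Mx.
case: maxM => [[_ _ _ MM]] M1 _; apply: M1; rewrite -(rmorph1 g) -xy rmorphM mulrC.
by apply: MM => //; apply: integral_el_id.
Qed.

End IntegralClosure.

(** * Total quotient ring and comparison of elements at a maximal ideal *)

Section TotalQuotient.
Local Open Scope ring_scope.
Variables (R T : comNzRingType) (g : {rmorphism R -> T}).
Hypothesis tq : total_quotient_of_red g.
Notation A := (integral_el g).

Lemma red_eq0 a : g a = 0 <-> nilpotent_el a. Proof. by case: tq. Qed.

Lemma red_sqr_eq0 x : g x * g x = 0 -> g x = 0.
Proof.
rewrite -rmorphM => /red_eq0[k]; rewrite -expr2 -exprM => e.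
by apply/red_eq0; exists (2 * k)%N.
Qed.

Lemma nzd_redP s : nzd_red s <-> (forall a, g a * g s = 0 -> g a = 0).
Proof.
split=> H a; first by rewrite -rmorphM => /red_eq0/H/red_eq0.
by move=> /red_eq0; rewrite rmorphM => /H/red_eq0.
Qed.

Lemma nzd_red_inv s : nzd_red s -> exists t, g s * t = 1.
Proof. by case: tq => _ + _; apply. Qed.

Lemma nzd_redM (s t : R) : nzd_red s -> nzd_red t -> nzd_red (s * t).
Proof. by move=> ns nt a; rewrite mulrA => /nt/ns. Qed.

Lemma common_denominator n (u : nat -> T) : exists c (a : nat -> R),
  nzd_red c /\ forall j, (j < n)%N -> u j * g c = g (a j).
Proof.
elim: n => [|n [c [a [nc Ha]]]].
  by exists 1, (fun=> 0); split=> // x; rewrite mulr1.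
case: tq => _ _ /(_ (u n))[b [s [ns e]]].
exists (c * s), (fun j => if j == n then b * c else a j * s); split.
  exact: nzd_redM.
move=> j; rewrite ltnS leq_eqVlt => /orP[/eqP->|ltjn].
  by rewrite eqxx !rmorphM -e; ring.
by rewrite ltn_eqF // !rmorphM -Ha //; ring.
Qed.

(* Add up a maximal family of orthogonal elements killing y. *)
Lemma orthogonal_complement y : noetherian R ->
  exists y', g y * g y' = 0 /\ nzd_red (y + y').
Proof.
move=> noe.
pose orth (s : seq R) := (forall i, (i < size s)%N -> g y * g s`_i = 0) /\
  (forall i j, (i < size s)%N -> (j < size s)%N -> i <> j -> g s`_i * g s`_j = 0).
pose F L := exists2 s, orth s & L = gen_ideal s.
have [||L [s [ys ss] ->] maxL] := @noetherian_maximal R F (gen_ideal [::]) noe.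
- by move=> _ [s _ ->]; apply: gen_ideal_ideal.
- by exists [::].
have yb : g y * g (\sum_(i < size s) s`_i) = 0.
  by rewrite rmorph_sum mulr_sumr big1 // => i _; apply: ys.
exists (\sum_(i < size s) s`_i); split=> //; apply/nzd_redP => a.
rewrite rmorphD mulrDr => e.
have ya : g y * g a = 0.
  rewrite -rmorphM; apply: red_sqr_eq0; rewrite !rmorphM.
  have -> : g y * g a * (g y * g a) =
    g a * g y * (g a * g y + g a * g (\sum_(i < size s) s`_i)) - g a * g a * (g y * g (\sum_(i <
      size s) s`_i)) by ring.
  by rewrite e yb !mulr0 subr0.
have sa i : (i < size s)%N -> g a * g s`_i = 0.
  move=> lis; rewrite -rmorphM; apply: red_sqr_eq0; rewrite !rmorphM.
  have e' : g a * g (\sum_(i < size s) s`_i) = 0 by rewrite mulrC in ya; move: e; rewrite ya add0r.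
  have := congr1 (fun z => z * (g a * g s`_i)) e'; rewrite mul0r => e0; rewrite -[RHS]e0.
  rewrite rmorph_sum mulr_sumr mulr_suml (bigD1 (Ordinal lis)) //= big1 ?addr0 // => j nji.
  have -> : g a * g s`_j * (g a * g s`_i) = g a * g a * (g s`_j * g s`_i) by ring.
  rewrite ss ?mulr0 // => eji; move/eqP: nji; apply; exact/val_inj.
(* Once maximality absorbs [a] into the ideal of [s], orthogonality to all of [s] makes [a]
   orthogonal to itself. *)
suff [c ea] : gen_ideal s a.
  apply: red_sqr_eq0; rewrite {2}ea rmorph_sum mulr_sumr big1 // => i _.
  by rewrite rmorphM mulrCA sa ?mulr0.
apply: (maxL (gen_ideal (a :: s))).
- exists (a :: s) => //; split=> [[|i] //= /ys//|[|i] [|j] //= li lj nij].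
  + exact: sa.
  + by rewrite mulrC; apply: sa.
  + by apply: ss => // eij; apply: nij; rewrite eij.
- apply: gen_ideal_sub; first exact: gen_ideal_ideal.
  by move=> i lis; apply: (@gen_ideal_mem _ (a :: s) i.+1).
- exact: (@gen_ideal_mem _ (a :: s) 0).
Qed.

Variables (m : R -> Prop) (q : nat) (M : T -> Prop).
Hypotheses (noe : noetherian R) (locm : local_with m) (dim1 : krull_dim_one R).
Hypotheses (resq : residue_card m q) (maxM : closure_maximal g M).

(** For [x] and [c] in [m], the homogeneous relation divided by [c ^+ d] is an equation for x/c with
    a coefficient outside [M], so [closure_maximal_valuative] applies. Otherwise [g c] and [g x]
    themselves serve as multipliers. *)
Lemma closure_comparable_nzd x c : nzd_red c ->
  exists a b, [/\ A a, A b, ~ (M a /\ M b) & a * g x = b * g c].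
Proof.
move=> nc; have [[mx mc]|nm] := pselect (m x /\ m c); last first.
  exists (g c), (g x); split; try exact: integral_el_id; last by rewrite mulrC.
  move=> [Mc Mx]; apply: nm.
  by split; apply: contrapT => /(closure_maximal_avoids noe locm maxM).
have [X [phi Hphi]] := finite_mod_nzd_red noe locm resq dim1 nc.
have [d [r [[j0 lej0 mj0] e]]] := homogeneous_relation locm resq mx mc Hphi.
have [ci eci] := nzd_red_inv nc.
have [|||a [Aa Aat nM]] := @closure_maximal_valuative _ _ g M d (g \o r) (g x * ci) maxM.
- by move=> i; apply: integral_el_id.
- have := congr1 (fun z => g z * ci ^+ d) e; rewrite rmorph0 mul0r => e0; rewrite -[RHS]e0.
  rewrite rmorph_sum mulr_suml; apply: eq_bigr => j _.
  have -> : ci ^+ d = ci ^+ j * ci ^+ (d - j) by rewrite -exprD subnKC // -ltnS.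
  have e1 : g c ^+ (d - j) * ci ^+ (d - j) = 1 by rewrite -exprMn eci expr1n.
  rewrite exprMn !rmorphM !rmorphXn /=.
  have -> : g (r j) * (g x ^+ j * g c ^+ (d - j)) * (ci ^+ j * ci ^+ (d - j)) =
    g (r j) * (g x ^+ j * ci ^+ j) * (g c ^+ (d - j) * ci ^+ (d - j)) by ring.
  by rewrite e1 mulr1.
- by exists j0 => //; apply: closure_maximal_avoids mj0.
exists a, (a * (g x * ci)); split=> //.
by rewrite -[LHS]mulr1 -eci; ring.
Qed.

(** Compare [x] with the non-zero-divisor [y + y']. If the idempotent [e] is outside [M], multiply
    the relation by [e]; otherwise [1 - e] is outside [M] and kills [g y]. *)
Lemma closure_comparable x y :
  exists a b, [/\ A a, A b, ~ (M a /\ M b) & a * g x = b * g y].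
Proof.
have [y' [yy' nc]] := orthogonal_complement y noe.
have [a [b [Aa Ab nM eab]]] := closure_comparable_nzd x nc.
have [ci eci] := nzd_red_inv nc.
have cM : closure_ideal g M by case: maxM.
(* e is the idempotent of T with the same support as y *)
pose e := g y * ci; rewrite rmorphD in eci eab.
have ey : e * (g y + g y') = g y.
  by rewrite -[RHS]mulr1 -eci /e; ring.
have ee : e * e = e.
  have -> : e * e = e * ci * (g y + g y') - ci * ci * (g y * g y') by rewrite /e; ring.
  by rewrite yy' mulr0 subr0 -mulrA [ci * _]mulrC eci mulr1.
have Ae : A e.
  exists ('X^2 - 'X); split.
    rewrite monicE lead_coefDl ?lead_coefXn //.
    by rewrite size_polyN size_polyX size_polyXn.
  by rewrite rmorphB rmorphXn /= map_polyX !hornerE expr2 ee subrr.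
have eyy : e * g y = g y by rewrite -[in LHS]ey mulrA ee.
have [Me|Me] := pselect (M e); last first.
  exists (a * e), b; split=> //; first exact: integral_elM.
    move=> [Mae Mb]; apply: nM; split=> //.
    by have [|] := closure_maximal_prime maxM Aa Ae Mae.
  by rewrite mulrAC eab -mulrA [_ * e]mulrC ey.
exists 0, (1 - e); split.
- exact: integral_el0.
- by apply: integral_elB => //; apply: integral_el1.
- move=> [_ M1e]; case: maxM => _ M1 _; apply: M1; rewrite -[1](subrK e).
  by case: cM => _ _ MD _; apply: MD.
- by rewrite mul0r mulrBl mul1r eyy subrr.
Qed.

(** Compare the running [y] with each new entry, collecting in [sg] the multipliers outside [M]. The
    starting value 0 can remain when the entries vanish locally at [M]. *)
Lemma closure_dominant (s : seq R) : exists y sg,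
  [/\ y = 0 \/ y \in s, A sg, ~ M sg &
      forall x, x \in s -> exists2 b, A b & sg * g x = b * g y].
Proof.
elim: s => [|a s [y [sg [_y Asg Msg Hs]]]].
  by exists 0, 1; split=> //; [left|exact: integral_el1|case: maxM].
have [al [be [Aal Abe nM eab]]] := closure_comparable a y.
have [Mal|Mal] := pselect (M al); last first.
  exists y, (sg * al); split.
  - by case: _y => [->|ys]; [left|right; rewrite inE ys orbT].
  - exact: integral_elM.
  - exact: (closure_maximal_notin_mul maxM).
  - move=> x; rewrite inE => /orP[/eqP->|/Hs[b Ab eb]].
      by exists (sg * be); [exact: integral_elM | rewrite -mulrA eab mulrA].
    by exists (al * b); [exact: integral_elM | rewrite mulrAC eb; ring].
have Mbe : ~ M be by move=> Mbe; apply: nM.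
exists a, (sg * be); split.
- by right; rewrite mem_head.
- exact: integral_elM.
- exact: (closure_maximal_notin_mul maxM).
- move=> x; rewrite inE => /orP[/eqP->|/Hs[b Ab eb]].
    by exists (sg * be); [exact: integral_elM|].
  exists (al * b); [exact: integral_elM |].
  have -> : sg * be * g x = be * (sg * g x) by ring.
  by rewrite eb mulrCA -eab; ring.
Qed.

(** Let [y] dominate [s] at [M]. Unless [g y] vanishes locally, take for [K] the elements that are
    locally an [M]-multiple of [y]. It omits [y], since from z y = mu y the element [z - mu],
    outside [M], would kill [y]. An element of the ideal outside [K] is locally a unit times [y],
    hence a generator. *)
Lemma closure_local (s : seq R) :
  (exists sg, [/\ A sg, ~ M sg & forall x, gen_ideal s x -> sg * g x = 0]) \/
  (exists K : R -> Prop, [/\ is_ideal K,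
     (forall r x, m r -> gen_ideal s x -> K (r * x)),
     (exists2 i, (i < size s)%N & ~ K s`_i) &
     forall b, gen_ideal s b -> ~ K b -> exists sg, [/\ A sg, ~ M sg &
       forall x, gen_ideal s x -> exists2 al, A al & sg * g x = al * g b]]).
Proof.
have [y [sg [_y Asg Msg Hs]]] := closure_dominant s.
have {}Hs x : gen_ideal s x -> exists2 b, A b & sg * g x = b * g y.
  move=> [c ->]; have /choice[b Hb] (i : 'I_(size s)) :
    exists b, A b /\ sg * g s`_i = b * g y by have [b Ab e] := Hs _ (mem_nth 0 (ltn_ord i));
      exists b.
  exists (\sum_(i < size s) g (c i) * b i).
    by apply: integral_el_sum => i _; apply: integral_elM (Hb i).1; apply: integral_el_id.
  rewrite rmorph_sum mulr_sumr mulr_suml; apply: eq_bigr => i _.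
  by rewrite rmorphM mulrCA (Hb i).2 mulrA.
have cM : closure_ideal g M by case: maxM.
have [MA M0 MD MM] := cM.
have [[z [Az Mz ezy]]|act] := pselect (exists z, [/\ A z, ~ M z & z * g y = 0]).
  left; exists (z * sg); split; [exact: integral_elM|exact: (closure_maximal_notin_mul maxM)|].
  by move=> x /Hs[b _ e]; rewrite -mulrA e mulrCA ezy mulr0.
right; pose K x := exists z mu, [/\ A z, ~ M z, M mu & z * g x = mu * g y].
have IK : is_ideal K.
  split=> [|x1 x2 [z1 [mu1 [Az1 Mz1 Mmu1 e1]]] [z2 [mu2 [Az2 Mz2 Mmu2 e2]]]|r x [z [mu [Az Mz Mmu
    e]]]].
  - by exists 1, 0; split=> //; [exact: integral_el1|case: maxM|rewrite rmorph0 mulr0 mul0r].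
  - exists (z1 * z2), (z2 * mu1 + z1 * mu2); split.
    + exact: integral_elM.
    + exact: (closure_maximal_notin_mul maxM).
    + by apply: MD; apply: MM.
    + rewrite rmorphD mulrDl -![_ * _ * g y]mulrA -e1 -e2; ring.
  - exists z, (g r * mu); split=> //; first by apply: MM => //; apply: integral_el_id.
    by rewrite rmorphM mulrCA e mulrA.
exists K; split=> //.
- move=> r x mr /Hs[b Ab e]; exists sg, (g r * b); split=> //.
    by rewrite mulrC; apply: MM => //; apply: (closure_maximal_contains noe locm maxM).
  by rewrite rmorphM mulrCA e mulrA.
- have nKy : ~ K y.
    move=> [z [mu [Az Mz Mmu e]]]; apply: act; exists (z - mu); split.
    + by apply: integral_elB => //; apply: MA.
    + by move=> Mzm; apply: Mz; rewrite -[z](subrK mu); apply: MD.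
    + by rewrite mulrBl e subrr.
  case: _y => [y0|/(nthP 0)[i lis eiy]]; last by exists i => //; rewrite eiy.
  by case: nKy; rewrite y0; apply: ideal_zero.
- move=> b Ib nKb; have [be Abe eb] := Hs _ Ib.
  have Mbe : ~ M be by move=> Mbe; apply: nKb; exists sg, be.
  exists (be * sg); split; [exact: integral_elM|exact: (closure_maximal_notin_mul maxM)|].
  move=> x /Hs[al Aal ex]; exists (al * sg); first exact: integral_elM.
  by rewrite -mulrA ex -[_ * sg * _]mulrA eb; ring.
Qed.

End TotalQuotient.

(** * Avoiding proper subspaces *)

Lemma geometric_bound q n : (1 < q)%N ->
  ((q ^ n.+1 - q) %/ (q - 1) = \sum_(i < n) q ^ i.+1)%N.
Proof.
move=> q1; rewrite (_ : q ^ n.+1 - q = (q - 1) * \sum_(i < n) q ^ i.+1)%N ?mulKn ?subn_gt0 //.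
elim: n => [|n IH]; first by rewrite big_ord0 muln0 expn1 subnn.
rewrite big_ord_recr /= mulnDr -IH mulnBl mul1n -expnS.
have := leq_pexp2l (ltnW q1) (isT : 0 < n.+1)%N; rewrite expn1.
have := leq_pexp2l (ltnW q1) (leqnSn n.+1); lia.
Qed.

(* All the sets contain v0, so averaging over the points other than v0 gives a
   strict inequality. *)
Lemma exists_rarely_covered (V X : finType) (v0 : V) (K : X -> {set V})
    (S : {set X}) q : (1 < q)%N ->
  {in S, forall i, v0 \in K i} -> {in S, forall i, q * #|K i| <= #|V|}%N ->
  (0 < #|S|)%N -> exists v, (q * #|[set i in S | v \in K i]| < #|S|)%N.
Proof.
move=> q1 K0 Kq S0; apply: contrapT => nov.
have {}nov v : (#|S| <= q * #|[set i in S | v \in K i]|)%N.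
  by rewrite leqNgt; apply/negP => h; apply: nov; exists v.
have dbl : (\sum_(v | v != v0) #|[set i in S | v \in K i]| = \sum_(i in S) #|K i :\ v0|)%N.
  under eq_bigr do rewrite -sum1_card.
  under [RHS]eq_bigr do rewrite -sum1_card.
  rewrite (exchange_big_dep (mem S)) /= => [|v i _]; last by rewrite inE => /andP[].
  by apply: eq_bigr => i Si; apply: eq_bigl => v; rewrite !inE Si.
have le1 : (#|V|.-1 * #|S| <= q * \sum_(i in S) #|K i :\ v0|)%N.
  rewrite -dbl big_distrr /= -(cardC1 v0) -sum_nat_const.
  by apply: leq_sum => v _; apply: nov.
have le2 : (q * \sum_(i in S) #|K i :\ v0| <= #|S| * (#|V| - q))%N.
  rewrite big_distrr -sum_nat_const; apply: leq_sum => i Si /=.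
  by have := Kq i Si; rewrite (cardsD1 v0 (K i)) K0 //= mulnDr muln1; lia.
have [i Si] := card_gt0P S0.
have : (q <= #|V|)%N.
  apply: leq_trans (Kq i Si); rewrite leq_pmulr //.
  by apply/card_gt0P; exists v0; apply: K0.
by nia.
Qed.

Section Avoidance.
Local Open Scope ring_scope.
Variables (R : comNzRingType) (m : R -> Prop) (q : nat).
Hypotheses (noe : noetherian R) (locm : local_with m) (resq : residue_card m q).
Variables (a : seq R) (X : finType) (K : X -> R -> Prop).

(** Encodes a proper subspace of I/mI, where I is the ideal generated by [a]. *)
Definition proper_over_max (L : R -> Prop) := [/\ is_ideal L,
  (forall r x, m r -> gen_ideal a x -> L (r * x)) &
  exists2 j, (j < size a)%N & ~ L a`_j].

(** Each [K i] contains at most a share 1/q of the combinations [phi v], so a suitable first element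
    leaves fewer than |S|/q ideals. As q + ... + q^(n+1) = q (1 + q + ... + q^n), strictness brings
    the rest within the bound for [n]. *)
Lemma avoid_ideals n (S : {set X}) :
  {in S, forall i, proper_over_max (K i)} -> (#|S| <= \sum_(i < n) q ^ i.+1)%N ->
  exists b : seq R, [/\ size b = n, {in b, forall x, gen_ideal a x} &
    {in S, forall i, exists2 x, x \in b & ~ K i x}].
Proof.
elim: n S => [|n IH] S KS leS.
  exists [::]; split=> // i Si; move: leS; rewrite big_ord0 leqn0 cards_eq0 => /eqP S0.
  by rewrite S0 inE in Si.
have q1 := residue_card_gt1 locm resq; have Im := local_ideal locm.
case: resq => rs [szrs inj sur].
pose V := {ffun 'I_(size a) -> 'I_q}.
pose phi (v : V) := \sum_(j < size a) rs`_(v j) * a`_j.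
have Iphi v : gen_ideal a (phi v).
  apply: ideal_sum => [|j _]; first exact: gen_ideal_ideal.
  by apply: ideal_mull; [exact: gen_ideal_ideal|exact: gen_ideal_mem].
pose W i := [set v : V | `[<K i (phi v)>]].
(* [v0] plays the zero vector: its entries represent the class 0 and lie in [m], but may be
   nonzero. *)
have [z0 ltz0 mz0] := sur 0.
pose v0 : V := [ffun=> Ordinal ltz0].
have mrz : m rs`_z0 by have -> : rs`_z0 = - (0 - rs`_z0); [ring | apply: ideal_opp].
have Wv0 : {in S, forall i, v0 \in W i}.
  move=> i /KS[IK mK _]; rewrite inE; apply/asboolP; apply: ideal_sum => // j _.
  by apply: mK; [rewrite ffunE | exact: gen_ideal_mem].
have Wq : {in S, forall i, q * #|W i| <= #|V|}%N.
  move=> i /KS[IK mK [j ltj nKj]].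
  (* Overwriting coordinate [j] is injective on pairs from [W i] and ['I_q]: two members of [W i]
     differing only at [j] would put a unit times the j-th generator into [K i]. *)
  pose upd (p : V * 'I_q) : V := [ffun l => if l == Ordinal ltj then p.2 else p.1 l].
  have inj_upd : {in finset.setX (W i) [set: 'I_q] &, injective upd}.
    move=> [v u] [v' u']; rewrite !finset.in_setX !inE !andbT /=.
    move=> /asboolP Kv /asboolP Kv' /ffunP e.
    have eu : u = u' by have := e (Ordinal ltj); rewrite !ffunE eqxx.
    congr (_, _) => //; apply/ffunP => l; have := e l; rewrite !ffunE.
    case: eqP => // -> _; apply: contrapT => nv; apply: nKj.
    have Kd : K i ((rs`_(v (Ordinal ltj)) - rs`_(v' (Ordinal ltj))) * a`_j).
      have -> : (rs`_(v (Ordinal ltj)) - rs`_(v' (Ordinal ltj))) * a`_j = phi v - phi v'.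
        rewrite -sumrB (bigD1 (Ordinal ltj)) //= big1 ?addr0 ?mulrBl // => k nk.
        by have := e k; rewrite !ffunE (negPf nk) => ->; rewrite subrr.
      exact: ideal_sub.
    have [|y ey] := @local_unit _ m noe locm (rs`_(v (Ordinal ltj)) - rs`_(v' (Ordinal ltj))).
      by move=> md; apply: nv; apply/val_inj; apply: inj md; apply: ltn_ord.
    by rewrite -[a`_j]mul1r -ey mulrAC; apply: ideal_mulr.
  have := max_card (mem (upd @: finset.setX (W i) [set: 'I_q])).
  by rewrite card_in_imset // cardsX cardsT card_ord mulnC.
have [S0|S0] := posnP #|S|.
  exists (nseq n.+1 0); split; first by rewrite size_nseq.
  - by move=> x /nseqP[-> _]; exact: (ideal_zero (gen_ideal_ideal _)).
  - by move=> i; rewrite (cards0_eq S0) inE.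
have [v ltv] := exists_rarely_covered q1 Wv0 Wq S0.
have [||b [sb Ib Kb]] := IH [set i in S | v \in W i].
- by move=> i; rewrite inE => /andP[/KS].
- rewrite -ltnS -(ltn_pmul2l (ltnW q1)); apply: leq_trans ltv _.
  by rewrite (leq_trans leS) // big_ord_recl mulnS leq_add2l big_distrr.
exists (phi v :: b); split=> /=; first by rewrite sb.
- by move=> x; rewrite inE => /orP[/eqP->|/Ib].
- move=> i Si; have [/asboolP Kv|/asboolP nKv] := boolP `[<K i (phi v)>].
    have [|x bx nKx] := Kb i; first by rewrite !inE Si; apply/asboolP.
    by exists x => //; rewrite inE bx orbT.
  by exists (phi v) => //; rewrite mem_head.
Qed.

End Avoidance.

(** * Reductions from integral dependence *)

Section DeterminantTrick.
Local Open Scope ring_scope.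
Variable R : comNzRingType.
Variables (I J : R -> Prop).
Hypotheses (II : is_ideal I) (IJ : is_ideal J) (JI : subI J I).

(** Telescoping: each replaced factor costs a term with one factor in [J] and the others in [I]. For
    the empty product the difference is 0, so the truncated predecessor is harmless. *)
Lemma prod_perturb (X : Type) (r : seq X) (u v : X -> R) :
  (forall i, I (u i)) -> (forall i, J (v i)) ->
  mulI J (powI I (size r).-1) (\prod_(i <- r) (u i - v i) - \prod_(i <- r) u i).
Proof.
move=> Iu Jv; have IJI k : is_ideal (mulI J (powI I k)) by apply/mulI_ideal/powI_ideal.
elim: r => [|i r IH]; first by rewrite !big_nil subrr; apply: ideal_zero.
rewrite !big_cons /=.
have -> : (u i - v i) * \prod_(j <- r) (u j - v j) - u i * \prod_(j <- r) u j =
  (u i - v i) * (\prod_(j <- r) (u j - v j) - \prod_(j <- r) u j) - v i * \prod_(j <- r) u j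
    by ring.
apply: ideal_sub => //; last first.
  apply: mulI_mem => //; rewrite -(big_map u predT id) -(size_map u).
  apply: powI_prod => x; elim: (r) => //= j r' IHr.
  by rewrite inE => /orP[/eqP->|].
case: r IH => [|j r] IH; first by rewrite !big_nil subrr mulr0; apply: ideal_zero.
rewrite mulrC [size _]/= -addn1; apply: mulI_powI => //.
exact: (powI1 (ideal_sub II (Iu i) (JI (Jv i)))).
Qed.

Lemma det_perturb L (x : R) (B : 'M[R]_L) : I x -> (forall i j, J (B i j)) ->
  mulI J (powI I L.-1) (\det (x%:M - B) - x ^+ L).
Proof.
move=> Ix JB; rewrite -(det_scalar L x) -sumrB.
have IJI k : is_ideal (mulI J (powI I k)) by apply/mulI_ideal/powI_ideal.
apply: ideal_sum => // s _; rewrite -mulrBr; apply: ideal_mull => //.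
have eL : size (index_enum 'I_L) = L by rewrite -sum1_size sum1_card card_ord.
have := @prod_perturb _ (index_enum 'I_L) (fun i => x%:M i (s i)) (fun i => B i (s i)).
rewrite eL => /(_ _ (fun i => JB i (s i))) H.
have -> : \prod_i (x%:M - B) i (s i) = \prod_i (x%:M i (s i) - B i (s i)).
  by apply: eq_bigr => i _; rewrite mxE [X in _ + X]mxE.
apply: H => i; rewrite mxE; case: (_ == _) => //=.
exact: ideal_zero.
Qed.

(** The determinant in the Cayley-Hamilton argument vanishes only up to nilpotents; this handles its
    powers while keeping a factor in [J]. *)
Lemma expr_perturb L (x z : R) e : I x -> mulI J (powI I L) z ->
  mulI J (powI I (L.+1 * e).-1) ((x ^+ L.+1 + z) ^+ e - x ^+ (L.+1 * e)).
Proof.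
move=> Ix Jz; have IJI k : is_ideal (mulI J (powI I k)) by apply/mulI_ideal/powI_ideal.
elim: e => [|e IH]; first by rewrite muln0 subrr; apply: ideal_zero.
have -> : (x ^+ L.+1 + z) ^+ e.+1 - x ^+ (L.+1 * e.+1) =
  ((x ^+ L.+1 + z) ^+ e - x ^+ (L.+1 * e)) * (x ^+ L.+1 + z) + z * x ^+ (L.+1 * e).
  by rewrite exprSr mulnS exprD; ring.
apply: ideal_add => //; last first.
  have -> : (L.+1 * e.+1).-1 = (L + L.+1 * e)%N by lia.
  by apply: mulI_powI => //; apply: powIX.
case: e IH => [|e] IH; first by rewrite muln0 subrr mul0r; apply: ideal_zero.
have -> : (L.+1 * e.+2).-1 = ((L.+1 * e.+1).-1 + L.+1)%N by lia.
apply: mulI_powI => //; apply: ideal_add; first exact: powI_ideal.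
  exact: powIX.
exact: (mulI_powI_sub JI).
Qed.

(** Once all generators share the exponent K + 1, every monomial of degree d + 1 contains some
    generator to that power, and thus yields a factor in [J]. *)
Lemma reduction_of_powers (s : seq R) : eqI I (gen_ideal s) ->
  (forall x, I x -> exists k, mulI J (powI I k) (x ^+ k.+1)) -> reduction J I.
Proof.
move=> Is dep; have eI : I = gen_ideal s by apply/funext => x; apply/propext; apply: Is.
split=> //.
have /choice[k Hk] (i : 'I_(size s)) : exists k, mulI J (powI I k) (s`_i ^+ k.+1).
  by apply: dep; rewrite eI; apply: gen_ideal_mem.
pose K := \max_i k i.
have IK (i : 'I_(size s)) : mulI J (powI I K) (s`_i ^+ K.+1).
  have leK : (k i <= K)%N by apply: leq_bigmax.
  have -> : K = (k i + (K - k i))%N by lia.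
  rewrite -addSn exprD; apply: mulI_powI => //; apply: powIX.
  by rewrite eI; apply: gen_ideal_mem.
pose d := (size s * K.+1).+1; exists d; split=> // x; split; last exact: mulI_powI_sub.
move: x; rewrite {1}eI; apply: (@powI_gen_pigeonhole _ _ K.+1).
- exact/mulI_ideal/powI_ideal.
- by rewrite ltnS leqW.
- move=> i z; rewrite -eI => Hz.
  have -> : d = (K + (d.+1 - K.+1))%N by rewrite /d; have := ltn_ord i; nia.
  exact: mulI_powI.
Qed.

Variables (T : comNzRingType) (g : {rmorphism R -> T}).

Definition in_span (X : finType) (w : X -> T) (t : T) :=
  exists c : X -> R, t = \sum_l g (c l) * w l.

Lemma in_span_mem (X : finType) (w : X -> T) l : in_span w (w l).
Proof.
exists (fun k => (k == l)%:R); rewrite (bigD1 l) //= eqxx rmorph1 mul1r big1 ?addr0 //.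
by move=> k /negPf->; rewrite rmorph0 mul0r.
Qed.

Lemma in_spanZ (X : finType) (w : X -> T) r t : in_span w t -> in_span w (g r * t).
Proof.
move=> [c ->]; exists (fun l => r * c l); rewrite mulr_sumr.
by apply: eq_bigr => l _; rewrite rmorphM mulrA.
Qed.

Lemma in_span_sum (X : finType) (w : X -> T) (Y : finType) (F : Y -> T) :
  (forall i, in_span w (F i)) -> in_span w (\sum_i F i).
Proof.
move=> /choice[c Hc]; exists (fun l => \sum_i c i l).
under eq_bigr do rewrite Hc.
rewrite exchange_big /=; apply: eq_bigr => l _.
by rewrite rmorph_sum mulr_suml.
Qed.

(** Adjoin one element at a time, multiplying the old family by the powers of [al n] below the
    degree of its monic equation. *)
Lemma integral_stable_span n (al : nat -> T) :
  (forall j, (j < n)%N -> integral_el g (al j)) ->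
  exists (X : finType) (w : X -> T) x0, w x0 = 1 /\
    forall j i, (j < n)%N -> in_span w (al j * w i).
Proof.
elim: n => [|n IH] Aal; first by exists unit, (fun=> 1), tt.
have [|X [w [x0 [w0 Hw]]]] := IH; first by move=> j ltj; apply/Aal/ltnW.
have [p [mp]] := Aal n (ltnSn n).
rewrite horner_coef size_map_poly_id0; last by rewrite (monicP mp) rmorph1 oner_neq0.
have [d sp] : exists d, size p = d.+1.
  by exists (size p).-1; rewrite prednK // lt0n size_poly_eq0 monic_neq0.
have pd : p`_d = 1 by move/monicP: mp; rewrite /lead_coef sp.
have gpd : (map_poly g p)`_d = 1 by rewrite coef_map /= pd rmorph1.
rewrite sp big_ord_recr /= gpd mul1r.
case: d {sp pd gpd} => [|d]; first by rewrite big_ord0 add0r expr0 => /eqP; rewrite oner_eq0.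
move=> e; pose w' (p : X * 'I_d.+1) := al n ^+ p.2 * w p.1.
exists (X * 'I_d.+1)%type, w', (x0, ord0); split; first by rewrite /w' w0 mulr1.
move=> j [i k]; rewrite ltnS leq_eqVlt => /orP[/eqP->|ltj].
  rewrite /w' /= mulrA -exprS.
  have [ltk|lek] := ltnP k d; last first; last
    by exact: (in_span_mem w' (i, Ordinal (ltk : (k.+1 < d.+1)%N))).
  have -> : k = d :> nat by have := ltn_ord k; lia.
  have -> : al n ^+ d.+1 * w i = \sum_(l < d.+1) g (- p`_l) * w' (i, l).
    move: e => /eqP; rewrite addr_eq0 => /eqP e.
    rewrite -[al n ^+ _]opprK -e mulNr mulr_suml -sumrN.
    by apply: eq_bigr => l _; rewrite rmorphN coef_map /w' /=; ring.
  by apply: in_span_sum => l; apply/in_spanZ/in_span_mem.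
have [c ec] := Hw j i ltj.
rewrite /w' /= mulrCA ec mulr_sumr; apply: in_span_sum => l.
by rewrite mulrCA; apply: in_spanZ; exact: (in_span_mem w' (l, k)).
Qed.

(** Cayley-Hamilton: on a finite family containing 1 whose span is stable under the [al j], [x] acts
    by a matrix [B] over [J]. So det(x - B) maps to 0 in [T] and is nilpotent in [R]; expanding its
    vanishing power gives the claim. *)
Lemma integral_dependence (b : seq R) (al : nat -> T) x :
  (forall a, g a = 0 -> nilpotent_el a) -> I x ->
  (forall j, (j < size b)%N -> J b`_j /\ integral_el g (al j)) ->
  g x = \sum_(j < size b) al j * g b`_j ->
  exists k, mulI J (powI I k) (x ^+ k.+1).
Proof.
move=> nil Ix Hb ex.
have [|X [w [x0 [w0 Hw]]]] := @integral_stable_span (size b) al; first by move=> j /Hb[].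
have /choice[c Hc] (p : 'I_(size b) * X) : in_span w (al p.1 * w p.2) by apply: Hw.
pose be i l := \sum_(j < size b) b`_j * c (j, i) l.
have Jbe i l : J (be i l).
  by apply: ideal_sum => // j _; apply: ideal_mulr => //; case: (Hb j).
have xw i : g x * w i = \sum_l g (be i l) * w l.
  rewrite ex mulr_suml; under [RHS]eq_bigr do rewrite rmorph_sum mulr_suml.
  rewrite exchange_big /=; apply: eq_bigr => j _.
  rewrite mulrAC (Hc (j, i)) mulr_suml; apply: eq_bigr => l _.
  by rewrite rmorphM; ring.
pose L := #|X|; pose B : 'M[R]_L := \matrix_(i, l) be (enum_val i) (enum_val l).
pose W : 'cV[T]_L := \col_i w (enum_val i).
have BW : map_mx g (x%:M - B) *m W = 0.
  rewrite map_mxB map_scalar_mx mulmxBl mul_scalar_mx; apply/matrixP => i k.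
  rewrite !mxE xw (reindex (@enum_val X X)) /=; last first.
    by apply: onW_bij; apply: enum_val_bij.
  by rewrite -sumrB big1 // => l _; rewrite !mxE subrr.
have /nil[e De] : g (\det (x%:M - B)) = 0.
  have := congr1 (mulmx (\adj (map_mx g (x%:M - B)))) BW.
  rewrite mulmxA mul_adj_mx mulmx0 mul_scalar_mx det_map_mx.
  move=> /matrixP/(_ (enum_rank x0) 0); rewrite !mxE enum_rankK w0 mulr1 => ->.
  by [].
have L0 : (0 < L)%N by apply/card_gt0P; exists x0.
have e0 : (0 < e)%N.
  by case: (posnP e) De => // -> /eqP; rewrite expr0 oner_eq0.
have Hd : mulI J (powI I L.-1) (\det (x%:M - B) - x ^+ L).
  by apply: det_perturb => // i j; rewrite mxE.
move: (\det _) De Hd => D De; rewrite -(prednK L0) => Hd.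
have := expr_perturb e Ix Hd; rewrite [x ^+ _ + _]addrC subrK De sub0r => H.
rewrite /= prednK // in H; exists (L * e).-1; rewrite prednK ?muln_gt0 ?L0 //.
by rewrite -[x ^+ _]opprK; exact: (ideal_opp (mulI_ideal J (powI_ideal I _)) H).
Qed.

End DeterminantTrick.

(** * Few maximal ideals: existence of reductions *)

Section FewMaximalIdeals.
Local Open Scope ring_scope.
Variables (R T : comNzRingType) (g : {rmorphism R -> T}) (m : R -> Prop) (q n : nat).
Hypotheses (noe : noetherian R) (locm : local_with m) (dim1 : krull_dim_one R).
Hypotheses (resq : residue_card m q) (tq : total_quotient_of_red g).
Notation A := (integral_el g).

(** The bound provides a longest list of distinct maximal ideals, and a longest list misses none. *)
Lemma closure_maximal_list N : card_max_closure_le g N ->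
  exists ms : seq (T -> Prop), (size ms <= N)%N /\
    (forall i, (i < size ms)%N -> closure_maximal g (nth (fun=> False) ms i)) /\
    (forall M, closure_maximal g M -> exists2 i, (i < size ms)%N & M = nth (fun=> False) ms i).
Proof.
move=> HN.
pose valid (s : seq (T -> Prop)) :=
  (forall i, (i < size s)%N -> closure_maximal g (nth (fun _ => False) s i)) /\
  (forall i j, (i < size s)%N -> (j < size s)%N ->
     (forall x, nth (fun _ => False) s i x <-> nth (fun _ => False) s j x) -> i = j).
have ex0 : exists k, `[<exists2 s, valid s & size s = k>].
  by exists 0%N; apply/asboolP; exists [::].
have ub k : `[<exists2 s, valid s & size s = k>] -> (k <= N)%N.
  by move=> /asboolP[s [v1 v2] <-]; apply: HN.
case: (ex_maxnP ex0 ub) => _ /asboolP[ms [v1 v2] <-] maxk.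
exists ms; split; first exact: HN.
split=> // M maxM; apply: contrapT => nM.
suff : (size (M :: ms) <= size ms)%N by rewrite ltnn.
apply: maxk; apply/asboolP; exists (M :: ms) => //; split=> [[|i] //= |[|i] [|j] //= li lj e].
- exact: v1.
- by case: nM; exists j => //; apply/funext => x; apply/propext; apply: e.
- by case: nM; exists i => //; apply/funext => x; apply/propext; apply: iff_sym.
- by congr _.+1; apply: v2.
Qed.

Lemma exists_reduction (I : R -> Prop) :
  card_max_closure_le g (\sum_(i < n) q ^ i.+1)%N -> is_ideal I ->
  exists J : R -> Prop, is_ideal J /\ n_generated n J /\ reduction J I.
Proof.
move=> cardM II; have [a Ia] := noe II.
have eI : I = gen_ideal a by apply/funext => x; apply/propext; apply: Ia.
have [ms [szms [maxms allms]]] := closure_maximal_list cardM.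
pose MM (i : 'I_(size ms)) := nth (fun=> False) ms i.
(* At an idle maximal ideal [I] vanishes locally, so no condition is imposed on [b] there. *)
pose idle i := exists sg, [/\ A sg, ~ MM i sg & forall x, I x -> sg * g x = 0].
pose good i (K : R -> Prop) := proper_over_max m a K /\
  forall b, I b -> ~ K b -> exists sg, [/\ A sg, ~ MM i sg &
       forall x, I x -> exists2 al, A al & sg * g x = al * g b].
have /choice[K HK] (i : 'I_(size ms)) : exists K, idle i \/ good i K.
  have := closure_local tq noe locm dim1 resq (maxms i (ltn_ord i)) a.
  rewrite -eI => -[H|[K [IK mK nK HK]]]; first by exists (fun=> True); left.
  by exists K; right; split=> //; split=> //; rewrite -eI.
pose S := [set i | `[<~ idle i>]].
have [||b [sb Ib Kb]] := @avoid_ideals R m q noe locm resq a _ K n S.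
- by move=> i; rewrite inE => /asboolP nid; have [|[]] := HK i.
- by apply: leq_trans szms; rewrite -[leqRHS]card_ord; apply: max_card.
have Ibj j : (j < size b)%N -> I b`_j by move=> lj; rewrite eI; apply/Ib/mem_nth.
pose J := gen_ideal b; exists J.
have IJ : is_ideal J by apply: gen_ideal_ideal.
split=> //; split; first by exists b.
have JI : subI J I by apply: gen_ideal_sub.
pose JA t := exists2 al : nat -> T, (forall j, A (al j)) & t = \sum_(j < size b) al j * g b`_j.
have JAm al x : A al -> x \in b -> JA (al * g x).
  move=> Aal /(nthP 0)[j ltj <-].
  exists (fun k => if k == j then al else 0).
    by move=> k; case: eqP => _ //; apply: integral_el0.
  rewrite (bigD1 (Ordinal ltj)) //= eqxx big1 ?addr0 // => k nk.
  by rewrite -val_eqE /= in nk; rewrite (negPf nk) mul0r.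
have loc i : exists sg, [/\ A sg, ~ MM i sg & forall x, I x -> JA (sg * g x)].
  have JA0 : JA 0.
    exists (fun=> 0); first by move=> _; apply: integral_el0.
    by rewrite big1 // => j _; rewrite mul0r.
  have [[sg [Asg Msg H]]|nid] := pselect (idle i).
    by exists sg; split=> // x /H->.
  have [//|[_ Hg]] := HK i.
  have [|x bx nKx] := Kb i; first by rewrite inE; apply/asboolP.
  have [|sg [Asg Msg H]] := Hg x _ nKx; first by rewrite eI; apply: Ib.
  by exists sg; split=> // y /H[al Aal ->]; apply: JAm.
(* The conductor of [I] into [JA]. No maximal ideal of the closure contains it, so it contains 1,
   and [I] maps into [JA]. *)
pose D t := A t /\ forall x, I x -> JA (t * g x).
have D1 : D 1.
  apply: contrapT => nD1.
  have [|M maxM DM] := @exists_closure_maximal R T g D _ nD1.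
    split=> [t []//| |t u [At Ht] [Au Hu]|r t Ar [At Ht]].
    - split=> [|x Ix]; first exact: integral_el0.
      rewrite mul0r; exists (fun=> 0); first by move=> _; apply: integral_el0.
      by rewrite big1 // => j _; rewrite mul0r.
    - split=> [|x Ix]; first exact: integral_elD.
      have [al Aal eal] := Ht x Ix; have [be Abe ebe] := Hu x Ix.
      exists (fun j => al j + be j); first by move=> j; apply: integral_elD.
      by rewrite mulrDl eal ebe -big_split; apply: eq_bigr => j _; rewrite mulrDl.
    - split=> [|x Ix]; first exact: integral_elM.
      have [al Aal eal] := Ht x Ix.
      exists (fun j => r * al j); first by move=> j; apply: integral_elM.
      by rewrite -mulrA eal mulr_sumr; apply: eq_bigr => j _; rewrite mulrA.
  have [i ltm eM] := allms M maxM.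
  have [sg [Asg Msg H]] := loc (Ordinal ltm).
  by apply: Msg; rewrite /MM /= -eM; apply: DM.
apply: (reduction_of_powers JI Ia) => x Ix.
have [_ /(_ x Ix)[al Aal]] := D1; rewrite mul1r => ex.
apply: (integral_dependence II IJ JI (g := g) (b := b) (al := al)) => //.
- by move=> y; case: tq => + _ _; move=> /(_ y)[].
- by move=> j ltj; split=> //; apply: gen_ideal_mem.
Qed.

End FewMaximalIdeals.

(** * Many maximal ideals *)

Section Points.
Local Open Scope ring_scope.
Variables (R : comNzRingType) (rs : seq R).

Fixpoint affine_points k : seq (seq R) :=
  if k is k'.+1 then [seq x :: v | x <- rs, v <- affine_points k'] else [:: [::]].

(* Points of projective k-space, normalised so that the first nonzero coordinate is 1. *)
Fixpoint projective_points k : seq (seq R) :=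
  if k is k'.+1 then
    [seq 1 :: v | v <- affine_points k] ++ [seq 0 :: v | v <- projective_points k']
  else [:: [:: 1]].

Lemma size_affine_points k : size (affine_points k) = (size rs ^ k)%N.
Proof. by elim: k => //= k IH; rewrite size_allpairs IH expnS. Qed.

Lemma size_projective_points k :
  size (projective_points k) = (\sum_(i < k) size rs ^ i.+1).+1.
Proof.
elim: k => [|k IH]; first by rewrite big_ord0.
rewrite [projective_points _]/= size_cat !size_map -/(affine_points k.+1) size_affine_points IH.
by rewrite big_ord_recr /= addnS addnC.
Qed.

Variable m : R -> Prop.
Hypotheses (noe : noetherian R) (locm : local_with m).
Hypothesis rs_sur : forall x, exists2 i, (i < size rs)%N & m (x - rs`_i).

Lemma affine_pointsP k (y : nat -> R) : exists2 v, v \in affine_points k &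
  forall i, (i < k)%N -> m (y i - v`_i).
Proof.
elim: k y => [|k IH] y; first by exists [::].
have [v vin Hv] := IH (fun i => y i.+1); have [j ltj mj] := rs_sur (y 0%N).
exists (rs`_j :: v); last by case.
by apply/allpairsP; exists (rs`_j, v); split=> //; apply: mem_nth.
Qed.

(** The first coordinate outside [m] is a unit and serves as the scalar [l]; later coordinates are
    divided by it and rounded to representatives. *)
Lemma projective_pointsP k (y : nat -> R) : (exists2 i, (i <= k)%N & ~ m (y i)) ->
  exists v l, [/\ v \in projective_points k, ~ m l &
    forall i, (i <= k)%N -> m (y i - l * v`_i)].
Proof.
have Im := local_ideal locm.
elim: k y => [|k IH] y [i lei nmi].
  exists [:: 1], (y 0%N); split; first by rewrite inE.
    by move: lei nmi; rewrite leqn0 => /eqP->.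
  by move=> j; rewrite leqn0 => /eqP-> /=; rewrite mulr1 subrr; apply: ideal_zero.
have [m0|nm0] := pselect (m (y 0%N)).
  have [|v [l [vin nml Hv]]] := IH (fun i => y i.+1).
    by case: i lei nmi => // i; exists i.
  exists (0 :: v), l; split=> //.
    by rewrite /= mem_cat; apply/orP; right; apply: map_f.
  by case=> [_|j] /=; [rewrite mulr0 subr0 | apply: Hv].
have [z ez] := local_unit noe locm nm0.
have [v vin Hv] := affine_pointsP k.+1 (fun i => z * y i.+1).
exists (1 :: v), (y 0%N); split=> //.
  by rewrite [projective_points _]/= mem_cat; apply/orP; left; apply: map_f.
case=> [_|j ltj] /=; first by rewrite mulr1 subrr; apply: ideal_zero.
have -> : y j.+1 - y 0%N * v`_j = y 0%N * (z * y j.+1 - v`_j).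
  by rewrite mulrBr mulrA ez mul1r.
by apply: ideal_mull => //; apply: Hv.
Qed.

End Points.

(** * Many maximal ideals: an ideal without n-generated reduction *)

Section ManyMaximalIdeals.
Local Open Scope ring_scope.
Variables (R T : comNzRingType) (g : {rmorphism R -> T}) (m : R -> Prop) (q n : nat).
Hypotheses (noe : noetherian R) (locm : local_with m).
Hypotheses (resq : residue_card m q) (tq : total_quotient_of_red g).
Notation A := (integral_el g).

(** Pairwise comaximality yields products [e i] congruent to 1 modulo [M i] and to 0 modulo the
    other ideals. *)
Lemma closure_chinese N (M : 'I_N -> T -> Prop) (u : 'I_N -> T) :
  (forall i, closure_maximal g (M i)) -> (forall i, A (u i)) ->
  (forall i j, i != j -> exists x, M j x /\ ~ M i x) ->
  exists2 t, A t & forall i, M i (t - u i).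
Proof.
move=> maxM Au dist.
have cM i : closure_ideal g (M i) by case: (maxM i).
have /choice[f Hf] (p : 'I_N * 'I_N) : exists f, A f /\ (p.1 != p.2 -> M p.1 (1 - f) /\ M p.2 f).
  have [/=|ne] := eqVneq p.1 p.2; first by exists 0; split=> //; apply: integral_el0.
  have [|mu [y [Mmu My e]]] := closure_maximal_comaximal (maxM p.1) (cM p.2).
    by move=> sub; have [x [Mx nMx]] := dist _ _ ne; apply/nMx/sub.
  exists y; split; first by case: (cM p.2) => + _ _ _; apply.
  by move=> _; split=> //; rewrite -e addrK.
have Af p : A (f p) by case: (Hf p).
pose e i := \prod_(j | j != i) f (i, j).
have Ae i : A (e i) by apply: integral_el_prod.
have e1 i : M i (1 - e i).
  rewrite /e; have [MA M0 MD MMul] := cM i.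
  apply: (big_rec (fun z => M i (1 - z))); first by rewrite subrr.
  move=> j z nji Mz.
  have [_ /=] := Hf (i, j); rewrite eq_sym => /(_ nji)[Mf _].
  have -> : 1 - f (i, j) * z = f (i, j) * (1 - z) + (1 - f (i, j)) by ring.
  by apply: (MD) => //; apply: MMul.
have e0 i j : i != j -> M j (e i).
  move=> nij; rewrite /e (bigD1 j) 1?eq_sym //= mulrC.
  have [MA M0 MD MMul] := cM j; apply: MMul; first exact: integral_el_prod.
  by have [_ /= /(_ nij)[]] := Hf (i, j).
exists (\sum_i e i * u i).
  by apply: integral_el_sum => i _; apply: integral_elM.
move=> i; have [MA M0 MD MMul] := cM i.
rewrite (bigD1 i) //= addrAC; apply: MD.
  have -> : e i * u i - u i = - (u i * (1 - e i)) by ring.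
  by apply: closure_idealN => //; apply: MMul.
apply: closure_ideal_sum (cM i) _ => j nji; rewrite mulrC.
by apply: MMul => //; apply: e0.
Qed.

(* The ideal generated by c times lifts u_0, ..., u_n of the homogeneous
   coordinates: n of its elements satisfy a common linear condition modulo m,
   which is a point of projective space, hence they all degenerate at the
   maximal ideal attached to that point. *)
Lemma card_max_closure_of_reductions :
  (forall I : R -> Prop, is_ideal I ->
     exists J : R -> Prop, is_ideal J /\ n_generated n J /\ reduction J I) ->
  card_max_closure_le g (\sum_(i < n) q ^ i.+1)%N.
Proof.
move=> red ms maxms distms; rewrite leqNgt; apply/negP => ltms.
have q1 := residue_card_gt1 locm resq; have Im := local_ideal locm.
case: resq => rs [szrs inj sur]; rewrite -szrs in ltms sur.
pose N := size ms; pose M (i : 'I_N) := nth (fun=> False) ms i.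
have maxM i : closure_maximal g (M i) by apply: maxms.
have cM i : closure_ideal g (M i) by case: (maxM i).
have dist (i j : 'I_N) : i != j -> exists x, M j x /\ ~ M i x.
  move=> nij; apply: contrapT => nx; move/eqP: nij; apply; apply/val_inj.
  apply: distms; [exact: ltn_ord|exact: ltn_ord|].
  have sub x : M j x -> M i x.
    by move=> Mjx; apply: contrapT => nMi; apply: nx; exists x.
  case: (maxM j) => _ _ /(_ (M i) (cM i) sub)[//|Mi1].
  by case: (maxM i) => _ /(_ Mi1).
(* There are at least as many maximal ideals as points; surplus ones get the empty list, whose
   coordinates all read as 0. *)
pose pt (i : nat) := nth [::] (projective_points rs n) i.
have /choice[u Hu] (j : nat) : exists t, A t /\ forall i, M i (t - g (pt i)`_j).
  have [|t At Ht] := @closure_chinese N M (fun i => g (pt i)`_j) maxM _ dist.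
    by move=> i; apply: integral_el_id.
  by exists t.
have [c [a [nc ea]]] := common_denominator tq n.+1 u.
have [ci eci] := nzd_red_inv tq nc.
pose I := gen_ideal (mkseq a n.+1).
have II : is_ideal I by apply: gen_ideal_ideal.
have IE x : I x -> exists l : nat -> R, x = \sum_(j < n.+1) l j * a j.
  move=> [l ->]; exists l; rewrite size_mkseq; apply: eq_bigr => j _.
  by rewrite nth_mkseq.
have [J [IJ [[b [szb Jb]] [JI [k [_ ek]]]]]] := red I II.
have /choice[l Hl] (i : 'I_n) : exists l : nat -> R, b`_i = \sum_(j < n.+1) l j * a j.
  by apply: IE; apply/JI/Jb/gen_ideal_mem; rewrite szb.
have /choice[cl Hcl] (x : R) : exists i : 'I_(size rs), m (x - rs`_i).
  by have [i lti mi] := sur x; exists (Ordinal lti).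
(* Two of the q^(n+1) vectors of representatives have the same values under the [n] linear forms
   modulo [m]; their difference is a nontrivial common zero. *)
have [y [[j0 lej0 nmj0] Hy]] : exists y : nat -> R, (exists2 j, (j <= n)%N & ~ m (y j)) /\
    forall i : 'I_n, m (\sum_(j < n.+1) l i j * y j).
  pose H (v : {ffun 'I_n.+1 -> 'I_(size rs)}) : {ffun 'I_n -> 'I_(size rs)} :=
    [ffun i => cl (\sum_(j < n.+1) l i j * rs`_(v j))].
  have [v [v' [nv eH]]] : exists v v', v <> v' /\ H v = H v'.
    apply: contrapT => noF.
    have /leq_card : injective H by move=> v v' e; apply: contrapT => nv; apply: noF; exists v, v'.
    by rewrite !card_ffun !card_ord leq_exp2l ?szrs // ltnn.
  exists (fun j => rs`_(v (inord j)) - rs`_(v' (inord j))); split.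
    apply: contrapT => ny; apply: nv; apply/ffunP => j; apply/val_inj.
    apply: inj; rewrite -?szrs ?ltn_ord //; apply: contrapT => nm; apply: ny.
    by exists (val j); [rewrite -ltnS ltn_ord | rewrite inord_val].
  move=> i; have -> : \sum_(j < n.+1) l i j * (rs`_(v (inord j)) - rs`_(v' (inord j))) =
    (\sum_(j < n.+1) l i j * rs`_(v j) - rs`_(H v i)) - (\sum_(j < n.+1) l i j * rs`_(v' j) -
      rs`_(H v' i)).
    rewrite eH opprB addrA subrK -sumrB; apply: eq_bigr => j _.
    by rewrite !inord_val mulrBr.
  by rewrite !ffunE; apply: ideal_sub => //; apply: Hcl.
have [v [lam [vin nmlam Hv]]] : exists v lam, [/\ v \in projective_points rs n, ~ m lam &
    forall i, (i <= n)%N -> m (y i - lam * v`_i)].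
  by apply: projective_pointsP noe locm sur _ _ _; exists j0.
have ltN : (index v (projective_points rs n) < N)%N.
  by apply: leq_trans ltms; rewrite -size_projective_points index_mem.
pose i0 := Ordinal ltN; pose Mi := M i0.
have ptv : pt i0 = v by rewrite /pt nth_index.
have [MA M0 MD MMul] := cM i0.
have Mlam : ~ Mi (g lam) by exact: (closure_maximal_avoids noe locm (maxM i0) nmlam).
have Mu j : (j <= n)%N -> Mi (g lam * u j - g (y j)).
  move=> lej; have [_ /(_ i0)] := Hu j; rewrite ptv => Mj.
  have -> : g lam * u j - g (y j) = g lam * (u j - g v`_j) - g (y j - lam * v`_j).
    by rewrite rmorphB rmorphM; ring.
  apply: closure_idealB (cM i0) _ _.
    by apply: MMul => //; apply: integral_el_id.
  by exact: (closure_maximal_contains noe locm (maxM i0) (Hv j lej)).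
have Au j : A (u j) by case: (Hu j).
have nMu : ~ Mi (u j0).
  move=> Muj; apply: (closure_maximal_avoids noe locm (maxM i0) nmj0).
  have -> : g (y j0) = g lam * u j0 - (g lam * u j0 - g (y j0)) by ring.
  apply: closure_idealB (cM i0) _ (Mu _ lej0).
  by apply: MMul => //; apply: integral_el_id.
(* Division by [c] carries [I] into the closure and [J] into [Mi], because the forms giving the
   generators of [J] vanish at the chosen point. *)
have gI x : I x -> A (g x * ci).
  move=> /IE[r ->]; rewrite rmorph_sum mulr_suml; apply: integral_el_sum => j _.
  rewrite rmorphM -ea // -!mulrA eci mulr1.
  by apply: integral_elM => //; apply: integral_el_id.
have gJ x : J x -> Mi (g x * ci).
  move=> /Jb[r ->]; rewrite rmorph_sum mulr_suml; apply: closure_ideal_sum (cM i0) _ => j _.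
  rewrite rmorphM -mulrA; apply: (MMul); first exact: integral_el_id.
  have ltj : (j < n)%N by rewrite -szb.
  rewrite (Hl (Ordinal ltj)).
  have Ab : A (g (\sum_(j1 < n.+1) l (Ordinal ltj) j1 * a j1) * ci).
    by apply: gI; rewrite -(Hl (Ordinal ltj)); apply/JI/Jb; exact: (gen_ideal_mem (ltn_ord j)).
  have [|//|//] := closure_maximal_prime (maxM i0) (integral_el_id g lam) Ab.
  have -> : g lam * (g (\sum_(j1 < n.+1) l (Ordinal ltj) j1 * a j1) * ci) =
    \sum_(j1 < n.+1) g (l (Ordinal ltj) j1) * (g lam * u j1 - g (y j1)) + g (\sum_(j1 < n.+1) l
      (Ordinal ltj) j1 * y j1).
    rewrite !rmorph_sum mulr_suml mulr_sumr -big_split; apply: eq_bigr => j1 _.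
    rewrite !rmorphM -ea //=.
    have -> : g lam * (g (l (Ordinal ltj) j1) * (u j1 * g c) * ci) =
      g (l (Ordinal ltj) j1) * (g lam * u j1) * (g c * ci) by ring.
    by rewrite eci; ring.
  apply: MD; last exact: (closure_maximal_contains noe locm (maxM i0) (Hy _)).
  apply: closure_ideal_sum (cM i0) _ => j1 _; apply: MMul; first exact: integral_el_id.
  by apply: Mu; rewrite -ltnS.
have gIk d x : powI I d x -> A (g x * ci ^+ d).
  elim: d x => [|d IH] x; first by rewrite mulr1 => _; apply: integral_el_id.
  move=> [s [Hs ->]]; rewrite rmorph_sum mulr_suml big_seq.
  apply: integral_el_sum => p /Hs[Ip Ip'].
  have -> : g (p.1 * p.2) * ci ^+ d.+1 = (g p.1 * ci) * (g p.2 * ci ^+ d).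
    by rewrite rmorphM exprS; ring.
  by apply: integral_elM; [exact: gI|exact: IH].
have gJI x : mulI J (powI I k) x -> Mi (g x * ci ^+ k.+1).
  move=> [s [Hs ->]]; rewrite rmorph_sum mulr_suml big_seq.
  apply: closure_ideal_sum (cM i0) _ => p /Hs[Jp Ip'].
  have -> : g (p.1 * p.2) * ci ^+ k.+1 = (g p.2 * ci ^+ k) * (g p.1 * ci).
    by rewrite rmorphM exprS; ring.
  by apply: MMul; [exact: gIk|exact: gJ].
have Ia : I (a j0).
  have := @gen_ideal_mem _ (mkseq a n.+1) j0; rewrite size_mkseq nth_mkseq //.
  by apply.
(* A power of [a j0] lies in J I^k; divided by [c ^+ k.+1], it puts a power of [u j0] into [Mi]. *)
have := gJI _ (iffLR (ek _) (powIX k.+1 Ia)).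
rewrite rmorphXn -ea // -exprMn -mulrA eci mulr1.
exact: (closure_maximal_notin_exp (maxM i0) (Au j0) nMu).
Qed.

End ManyMaximalIdeals.

Theorem theorem3p1 (R : comNzRingType) (m : R -> Prop) (q n : nat)
  (T : comNzRingType) (g : {rmorphism R -> T}) :
  local_with m -> noetherian R -> krull_dim_one R ->
  residue_card m q -> (0 < n)%N ->
  total_quotient_of_red g ->
  (forall I : R -> Prop, is_ideal I ->
     exists J : R -> Prop, is_ideal J /\ n_generated n J /\ reduction J I)
  <-> card_max_closure_le g ((q ^ n.+1 - q) %/ (q - 1)).
Proof.
move=> locm noe dim1 resq _ tq.
rewrite (geometric_bound n (residue_card_gt1 locm resq)).
split; first exact: (card_max_closure_of_reductions noe locm resq tq).
by move=> cardM I; exact: (exists_reduction noe locm dim1 resq tq).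
Qed.
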